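(* Let $V\simeq\mathbb{C}^n$, $1\le\ell\le n-1$, and let $(\alpha^1,\dots,\alpha^{2k})$ be a Schubert problem for $\mathrm{Gr}(\ell,V)$ with $\alpha^{2i-1}_j+\alpha^{2i}_{\ell+1-j}\ge n+1$ for all $i=1,\dots,k$ and $j=1,\dots,\ell$. Let $F^1_\bullet,\dots,F^{2k}_\bullet$ be general (complete) flags in $V$, and for $i=1,\dots,k$ let $\Phi^i$ be an invertible $n\times n$ matrix such that $F^{2i-1}_\bullet=R_\bullet(\Phi^i)$ and $F^{2i}_\bullet=R_\bullet(w_0\Phi^i)$. Then the system of equations $$(M\Phi^k)(\Phi^i)^{-1}N_i\;=\;0_{\ell\times(n-\ell)}\qquad\text{for } i=1,\dots,k-1,$$ where $(M,N_1,\dots,N_{k-1})\in\mathcal{M}_{\alpha^{2k-1}}^{\alpha^{2k}}\times\mathcal{N}_{\alpha^1}^{\alpha^2}\times\dots\times\mathcal{N}_{\alpha^{2k-3}}^{\alpha^{2k-2}}$, defines the instance $$X_{\alpha^1}F^1_\bullet\cap X_{\alpha^2}F^2_\bullet\cap\dots\cap X_{\alpha^{2k}}F^{2k}_\bullet$$ of the Schubert problem (via $(M,N_1,\dots,N_{k-1})\mapsto R_\ell(M\Phi^k)$, which identifies the set of common zeroes bijectively with the points of the intersection) as the common zeroes of $(k-1)\cdot\ell(n-\ell)$ bilinear equations in $$\sum_{i=1}^{k}\bigl(\ell(n-\ell)-|\alpha^{2i-1}|-|\alpha^{2i}|\bigr)\;=\;(k-1)\cdot\ell(n-\ell)$$ variables,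 exhibiting the Schubert problem as a square system of equations (as many equations as variables).
   Context: Notation. $[n]=\{1,\dots,n\}$. Fix a basis $e_1,\dots,e_n$ of the complex vector space $V$ corresponding to columns of matrices. $\mathrm{Gr}(\ell,V)$ is the Grassmannian of $\ell$-dimensional linear subspaces of $V$. For a full rank matrix $M$ with $n$ columns, $R_\ell(M)$ is the span of its first $\ell$ rows; for an invertible $n\times n$ matrix $\Phi$, $R_\bullet(\Phi)$ is the complete flag $R_1(\Phi)\subsetneq\dots\subsetneq R_n(\Phi)=V$. $w_0$ is the permutation $i\mapsto n+1-i$ (and its permutation matrix), so $w_0\Phi$ is $\Phi$ with its rows in reverse order and $R_i(w_0\Phi)$ is the span of the last $i$ rows of $\Phi$. Any two flags in linear general position ($\dim F_i\cap F'_j=\max\{0,i+j-n\}$ for all $i,j$) have the form $R_\bullet(\Phi),R_\bullet(w_0\Phi)$ for some invertible $\Phi$. Schubert varieties. $\binom{[n]}{\ell}$ is the set of increasing sequences $\alpha=(\alpha_1<\dots<\alpha_\ell)$ in $[n]$. For a complete flag $F_\bullet$, $X_\alpha F_\bullet=\{H\in \mathrm{Gr}(\ell,V):\dim(H\cap F_{\alpha_i})\ge i,\ i=1,\dots,\ell\}$, of codimension $|\alpha|=\ell(n-\ell)-\sum_i(\alpha_i-i)$. A Schubert problem is a list $(\alpha^1,\dots,\alpha^s)$ of elements of $\binom{[n]}{\ell}$ with $\sum_i|\alpha^i|=\ell(n-\ell)$ (the trivial condition $(n-\ell+1,\dots,n)$, with $|\cdot|=0$, is allowed; adding one if necessary makes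 $s=2k$ even). ''General flags'' means that the tuple of flags lies in a suitable dense Zariski open subset of the product of the varieties of complete flags. Local coordinates. For $\alpha,\beta\in\binom{[n]}{m}$ with $\alpha_i+\beta_{m+1-i}\ge n+1$ for all $i$, $\mathcal{M}_\alpha^\beta$ is the set of $m\times n$ matrices $(m_{i,j})$ with $m_{i,j}=0$ if $j<n+1-\beta_{m+1-i}$ or $j>\alpha_i$, $m_{i,j}=1$ if $j=n+1-\beta_{m+1-i}$, and $m_{i,j}$ otherwise free. For $\alpha\in\binom{[n]}{\ell}$, $\alpha^\perp\in\binom{[n]}{n-\ell}$ is defined by: $j\in\alpha^\perp$ iff $n+1-j\notin\alpha$. For $\alpha,\beta\in\binom{[n]}{\ell}$ with $\alpha_i+\beta_{\ell+1-i}\ge n+1$ for all $i$, $\mathcal{N}_\alpha^\beta=\{M^T: M\in\mathcal{M}^{\alpha^\perp}_{\beta^\perp}\}$ (lower index $\beta^\perp$, upper index $\alpha^\perp$), a set of $n\times(n-\ell)$ matrices. $\mathcal{M}_\alpha^\beta$ and $\mathcal{N}_\alpha^\beta$ are affine spaces of dimension $\ell(n-\ell)-|\alpha|-|\beta|$; their free entries are the variables. *)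

(* Defs.v *)
From mathcomp Require Export all_boot all_order all_algebra perm.
From mathcomp Require Export classical_sets functions reals complex mpoly.
Set Implicit Arguments.
Unset Strict Implicit.
Unset Printing Implicit Defensive.
Import Order.TTheory GRing.Theory Num.Theory.
Local Open Scope ring_scope.

(* An element alpha = (alpha_1 < ... < alpha_m) of binom([n], m) is encoded as
   a set A : {set 'I_n} with #|A| = m, where x : 'I_n stands for x.+1 in [n]. *)

(* alpha_i, with 1-based index and 1-based value; the value at i = 0 is junk. *)
Definition elt (n : nat) (A : {set 'I_n}) (i : nat) : nat :=
  nth 0%N (0%N :: [seq (val x).+1 | x <- enum A]) i.

Definition codim (n l : nat) (A : {set 'I_n}) : nat :=
  (l * (n - l) - \sum_(1 <= i < l.+1) (elt A i - i))%N.

(* rev_ord is j |-> n+1-j in 1-based terms. *)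
Definition perp (n : nat) (A : {set 'I_n}) : {set 'I_n} :=
  [set j | rev_ord j \notin A]%SET.

Definition schubert_problem (n l s : nat) (al : 'I_s -> {set 'I_n}) : Prop :=
  (forall t, #|al t| = l) /\ (\sum_(t < s) codim l (al t) = l * (n - l))%N.

Definition compatible (n m : nat) (A B : {set 'I_n}) : Prop :=
  forall j, (1 <= j <= m)%N -> (n.+1 <= elt A j + elt B (m.+1 - j))%N.

(* The i-th pair (1-based i in [k], encoded by i - 1 : 'I_k) consists of the
   members 2i - 1 and 2i of the list, encoded by 2i - 2 and 2i - 1. *)
Lemma idx_odd_subproof (k : nat) (i : 'I_k) : (i.*2 < k.*2)%N.
Proof. by rewrite ltn_double. Qed.
Lemma idx_even_subproof (k : nat) (i : 'I_k) : (i.*2.+1 < k.*2)%N.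
Proof. by rewrite ltn_Sdouble. Qed.
Definition idx_odd (k : nat) (i : 'I_k) : 'I_k.*2 :=
  Ordinal (idx_odd_subproof i).
Definition idx_even (k : nat) (i : 'I_k) : 'I_k.*2 :=
  Ordinal (idx_even_subproof i).

Lemma last_pair_subproof (k : nat) : (0 < k)%N -> (k.-1 < k)%N.
Proof. by case: k. Qed.
Definition last_pair (k : nat) (hk : (0 < k)%N) : 'I_k :=
  Ordinal (last_pair_subproof hk).
Definition early_pair (k : nat) (i : 'I_k.-1) : 'I_k :=
  widen_ord (leq_pred k) i.

(* F j is the j-dimensional member of the flag, 0 <= j <= n. *)
Definition flag_data (C : fieldType) (n : nat) : Type :=
  'I_n.+1 -> {vspace 'rV[C]_n}.

Definition is_flag (C : fieldType) (n : nat) (F : flag_data C n) : Prop :=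
  (forall j, \dim (F j) = j) /\
  (forall i j : 'I_n.+1, (i <= j)%N -> (F i <= F j)%VS).

Definition row_span (C : fieldType) (m n : nat) (j : nat) (M : 'M[C]_(m, n)) :
    {vspace 'rV[C]_n} :=
  (\sum_(r < m | (r < j)%N) <[row r M]>)%VS.

Definition row_flag (C : fieldType) (n : nat) (Phi : 'M[C]_n) :
    flag_data C n :=
  fun j => row_span j Phi.

Definition w0 (C : fieldType) (n : nat) : 'M[C]_n :=
  perm_mx (perm (@rev_ord_inj n)).

Definition schubert_variety (C : fieldType) (n l : nat) (A : {set 'I_n})
    (F : flag_data C n) : set {vspace 'rV[C]_n} :=
  fun H => \dim H = l /\
    forall i, (1 <= i <= l)%N -> (i <= \dim (H :&: F (inord (elt A i))))%N.

Definition flag_tuples (C : fieldType) (n s : nat) :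
    set ('I_s -> flag_data C n) :=
  fun F => forall t, is_flag (F t).

(* Polynomials in all the entries of an s-tuple of n x n matrices. *)
Definition matpoly (C : fieldType) (n s : nat) : Type :=
  {mpoly C[#|{: 'I_s * 'I_n * 'I_n}|]}.
Definition matpoly_eval (C : fieldType) (n s : nat) (p : matpoly C n s)
    (Psi : 'I_s -> 'M[C]_n) : C :=
  p.@[fun v => let: (t, i, j) := enum_val v in Psi t i j].

(* The Zariski topology on the product of s copies of the variety of complete
   flags, seen as the quotient of GL_n^s by Psi |-> (row_flag (Psi t))_t: a set
   of tuples of flags is open iff its preimage in GL_n^s is. *)
Definition zariski_open (C : fieldType) (n s : nat)
    (U : set ('I_s -> flag_data C n)) : Prop :=
  (U `<=` @flag_tuples C n s)%classic /\
  exists P : set (matpoly C n s),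
    forall Psi : 'I_s -> 'M[C]_n, (forall t, Psi t \in unitmx) ->
      (U (fun t => row_flag (Psi t)) <->
       exists2 p, P p & matpoly_eval p Psi != 0).

Definition zariski_dense (C : fieldType) (n s : nat)
    (U : set ('I_s -> flag_data C n)) : Prop :=
  forall W : set ('I_s -> flag_data C n),
    zariski_open W -> (W !=set0)%classic -> (U `&` W !=set0)%classic.

(* i and j are 0-based, so the condition is on m_{i.+1,j.+1}, and
   m + 1 - (i + 1) = m - i. *)
Definition calM (C : fieldType) (n m : nat) (A B : {set 'I_n}) :
    set 'M[C]_(m, n) :=
  fun M => forall (i : 'I_m) (j : 'I_n),
    [/\ (j.+1 < n.+1 - elt B (m - i))%N -> M i j = 0,
        (elt A i.+1 < j.+1)%N -> M i j = 0 &
        (j.+1 = n.+1 - elt B (m - i))%N -> M i j = 1].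

Definition calM_free (n m : nat) (A B : {set 'I_n}) (i : 'I_m) (j : 'I_n) :
    bool :=
  (n.+1 - elt B (m - i) < j.+1 <= elt A i.+1)%N.

Definition calN (C : fieldType) (n l : nat) (A B : {set 'I_n}) :
    set 'M[C]_(n, n - l) :=
  fun N => calM (perp B) (perp A) N^T.

Definition calN_free (n l : nat) (A B : {set 'I_n}) (i : 'I_n)
    (j : 'I_(n - l)) : bool :=
  calM_free (perp B) (perp A) j i.

(* Tuples (M, N_1, ..., N_{k-1}). *)
Definition unknowns (C : fieldType) (n l k : nat) : Type :=
  ('M[C]_(l, n) * {ffun 'I_k.-1 -> 'M[C]_(n, n - l)})%type.

Definition coord_space (C : fieldType) (n l k : nat) (hk : (0 < k)%N)
    (al : 'I_k.*2 -> {set 'I_n}) : set (unknowns C n l k) :=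
  fun X =>
    calM (al (idx_odd (last_pair hk))) (al (idx_even (last_pair hk))) X.1 /\
    forall i : 'I_k.-1,
      calN (al (idx_odd (early_pair i))) (al (idx_even (early_pair i)))
        (X.2 i).

Definition system_mx (C : fieldType) (n l k : nat) (hk : (0 < k)%N)
    (Phi : 'I_k -> 'M[C]_n) (X : unknowns C n l k) (i : 'I_k.-1) :
    'M[C]_(l, n - l) :=
  (X.1 *m Phi (last_pair hk)) *m invmx (Phi (early_pair i)) *m X.2 i.

Definition common_zeros (C : fieldType) (n l k : nat) (hk : (0 < k)%N)
    (al : 'I_k.*2 -> {set 'I_n}) (Phi : 'I_k -> 'M[C]_n) :
    set (unknowns C n l k) :=
  fun X => coord_space hk al X /\ forall i, system_mx hk Phi X i = 0.

(* Positions of the entries of M (inl) and of N_1, ..., N_{k-1} (inr). *)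
Definition entry_pos (n l k : nat) : Type :=
  ('I_l * 'I_n + 'I_k.-1 * 'I_n * 'I_(n - l))%type.

Definition entry (C : fieldType) (n l k : nat) (X : unknowns C n l k)
    (v : entry_pos n l k) : C :=
  match v with
  | inl (r, c) => X.1 r c
  | inr (i, r, c) => X.2 i r c
  end.

Definition is_var (n l k : nat) (hk : (0 < k)%N)
    (al : 'I_k.*2 -> {set 'I_n}) (v : entry_pos n l k) : bool :=
  match v with
  | inl (r, c) =>
      calM_free (al (idx_odd (last_pair hk))) (al (idx_even (last_pair hk)))
        r c
  | inr (i, r, c) =>
      calN_free (al (idx_odd (early_pair i))) (al (idx_even (early_pair i)))
        r c
  end.

Definition nvars (n l k : nat) (hk : (0 < k)%N)
    (al : 'I_k.*2 -> {set 'I_n}) : nat :=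
  #|[pred v : entry_pos n l k | is_var hk al v]|.

Definition var_pos (n l k : nat) (hk : (0 < k)%N)
    (al : 'I_k.*2 -> {set 'I_n}) (t : 'I_(nvars l hk al)) : entry_pos n l k :=
  enum_val t.

Definition coords (C : fieldType) (n l k : nat) (hk : (0 < k)%N)
    (al : 'I_k.*2 -> {set 'I_n}) (X : unknowns C n l k) :
    'I_(nvars l hk al) -> C :=
  fun t => entry X (var_pos t).
Arguments coords {C n l k} hk al X t.

Definition in_M (n l k : nat) (v : entry_pos n l k) : bool :=
  if v is inl _ then true else false.
Definition in_N (n l k : nat) (i : 'I_k.-1) (v : entry_pos n l k) : bool :=
  if v is inr (i', _, _) then i' == i else false.

(* Since some entries of M and N_i are the constant 1, "bilinear" allows terms
   of lower degree: every monomial has degree at most one in the variables of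
   M, at most one in those of N_i, and involves no other variable. *)
Definition bilinear_in (C : fieldType) (n l k : nat) (hk : (0 < k)%N)
    (al : 'I_k.*2 -> {set 'I_n}) (i : 'I_k.-1)
    (p : {mpoly C[nvars l hk al]}) : Prop :=
  forall m, m \in msupp p ->
    [/\ (\sum_(t | in_M (var_pos t)) m t <= 1)%N,
        (\sum_(t | in_N i (var_pos t)) m t <= 1)%N &
        forall t, ~~ in_M (var_pos t) -> ~~ in_N i (var_pos t) -> m t = 0%N].

(* Main.v *)
Require Import Defs.
From mathcomp Require Import zify.
Set Implicit Arguments.
Unset Strict Implicit.
Unset Printing Implicit Defensive.
Import Order.TTheory GRing.Theory Num.Theory.
Local Open Scope ring_scope.

(* In the coordinates given by Phi^i, the rows of a matrix of calM normalize
   vectors of H lying in F_(alpha_i) and F'_(beta_(l+1-i)).  A normal form exists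
   and is unique as soon as no nonzero vector of H lies in F_(alpha_i) and in
   F'_(beta_(l+1-i) - 1) for some i; the matrices N_i are the normal forms of the
   annihilator of H, for which the condition is dual.

   It remains to see that these conditions hold for general flags.  A tuple of
   flags for which they fail at a point H of the intersection is represented by
   matrices (1 - N_t) P_t (1 + A), where 1 + A describes H in reduced echelon
   form, N_t is supported on the jumps of H in the t-th flag, and the rows of P_t
   at the jumps lie in a coordinate subspace.  There are at most s n^2 parameters,
   with equality only if the jumps are exactly the prescribed ones; in that case
   the failure makes a square submatrix of entries of the P_t singular, which
   removes one more parameter.  Since more polynomials than variables are
   algebraically dependent, a nonzero polynomial vanishes on all bad tuples. *)

(** * Positions in subsets of an interval *)

(** A normal form can fail at the boundary of the intersection of two opposite Schubert varieties,
    so every point of the full intersection must avoid the boundary of each pair; this concerns the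
    whole tuple of flags. The parameter bound arises as follows: [A] has l(n-l) entries, the
    dimension of the Grassmannian; each [P_t] loses l(n-l) of its n^2 entries to the coordinate
    subspace; [N_t] has at most l(n-l) - |alpha^t| entries. The codimensions add up to l(n-l), so
    the total is at most s n^2, the number of matrix entries. For the prescribed jumps there is no
    slack, and the singular minor has to supply the missing parameter. A determinant equation is not
    a parametrization, so the minor is used through a linear dependence of its rows: m entries of
    one row give way to m - 1 coefficients. In the dual case the minor is first seen to have a
    kernel on the column side, which is then turned to the row side. Jump sets, rows, columns and
    the chosen row range over a finite set, so a product of polynomials serves for all cases. *)

Definition cnt (n : nat) (A : {set 'I_n}) (x : nat) : nat :=
  #|[set a in A | (a < x)%N]%SET|.

Section Positions.
Local Open Scope nat_scope.
Variable n : nat.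
Implicit Types (A B : {set 'I_n}) (i x : nat).

Definition vals A : seq nat := [seq val a | a <- enum A].

Lemma vals_sorted A : sorted ltn (vals A).
Proof.
rewrite /vals sorted_map; apply: sorted_filter.
  by move=> x y z; apply: ltn_trans.
by rewrite -sorted_map -enumT val_enum_ord iota_ltn_sorted.
Qed.

Lemma size_vals A : size (vals A) = #|A|.
Proof. by rewrite size_map -cardE. Qed.

Lemma cntE A x : cnt A x = count (fun y => y < x) (vals A).
Proof.
rewrite /cnt /vals count_map cardE -size_filter; congr size.
rewrite {1 2}/enum_mem -filter_predI; apply: eq_filter => a /=.
by rewrite !inE andbC.
Qed.

Lemma leq_cnt A x y : x <= y -> cnt A x <= cnt A y.
Proof.
move=> le_xy; apply: subset_leq_card; apply/fintype.subsetP => a.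
by rewrite !inE => /andP[-> /leq_trans]; apply.
Qed.

Lemma eltS A i : i < #|A| -> elt A i.+1 = (nth 0 (vals A) i).+1.
Proof.
move=> hi; rewrite /elt /= -[RHS](nth_map 0 0 succn) ?size_vals //.
by rewrite -map_comp.
Qed.

Lemma cnt_elt_pred A i : 0 < i <= #|A| -> cnt A (elt A i).-1 = i.-1.
Proof.
case: i => // i /= hi; rewrite eltS //= cntE.
by rewrite (@count_lt_nth _ nat 0) ?size_vals //; apply: vals_sorted.
Qed.

Lemma cnt_elt A i : 0 < i <= #|A| -> cnt A (elt A i) = i.
Proof.
case: i => // i /= hi; rewrite eltS //= cntE.
by rewrite (@count_le_nth _ nat 0) ?size_vals //; apply: vals_sorted.
Qed.

Lemma elt_gt0 A i : 0 < i <= #|A| -> 0 < elt A i.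
Proof. by case: i => // i /= hi; rewrite eltS. Qed.

(** [elt] and [cnt] form a Galois connection: conditions indexed by the elements of a set become
    inequalities at every threshold [x], which pass easily to complements and mirror images. *)
Lemma elt_le_cnt A i x : 0 < i <= #|A| -> (elt A i <= x) = (i <= cnt A x).
Proof.
move=> hi; apply/idP/idP => [h|]; first by rewrite -{1}(cnt_elt hi) leq_cnt.
apply: contraLR; rewrite -!ltnNge => h.
have := @leq_cnt A x (elt A i).-1; rewrite (cnt_elt_pred hi).
by have := elt_gt0 hi; case: i hi h => //; lia.
Qed.


Lemma cnt_sum A x : cnt A x = \sum_(a < n | a \in A) (a < x).
Proof.
rewrite /cnt -sum1_card -big_mkcondr /=; apply: eq_bigl => a.
by rewrite !inE.
Qed.

Lemma cnt_full A : cnt A n = #|A|.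
Proof. by apply: eq_card => a; rewrite !inE ltn_ord andbT. Qed.

Lemma cnt_le_card A x : cnt A x <= #|A|.
Proof. by apply: subset_leq_card; apply/fintype.subsetP => a; rewrite !inE => /andP[]. Qed.

Lemma cnt0 A : cnt A 0 = 0.
Proof. by apply: eq_card0 => a; rewrite !inE ltn0 andbF. Qed.

Lemma sum_ord_lt x : x <= n -> \sum_(a < n) (a < x) = x.
Proof.
move=> le_xn; rewrite -big_mkcond /=.
by rewrite -(big_ord_widen n (fun=> 1)) // sum1_card card_ord.
Qed.

Lemma cntC A x : x <= n -> cnt (~: A)%SET x + cnt A x = x.
Proof.
move=> le_xn; rewrite -[RHS](sum_ord_lt le_xn) (bigID (mem A)) /= addnC !cnt_sum.
by congr (_ + _); apply: eq_bigl => a; rewrite !inE.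
Qed.

Lemma cnt_rev A x : x <= n ->
  cnt [set j | rev_ord j \in A]%SET x + cnt A (n - x) = #|A|.
Proof.
move=> le_xn; rewrite cnt_sum (reindex_inj rev_ord_inj) /=.
rewrite (eq_bigl (mem A)) => [|a]; last by rewrite !inE rev_ordK.
rewrite cnt_sum -big_split -sum1_card /=; apply: eq_bigr => a _.
by have := ltn_ord a; lia.
Qed.

(** [perp A] is the complement of the mirror image of [A], and the mirror image has below [x] as
    many elements as [A] has from [n - x] on. *)
Lemma cnt_perp A x : x <= n -> cnt (perp A) x + #|A| = x + cnt A (n - x).
Proof.
move=> le_xn; rewrite -(cnt_rev A le_xn) addnA; congr (_ + _).
rewrite -[RHS](cntC [set j | rev_ord j \in A]%SET le_xn); congr (cnt _ _ + _).
by apply/setP => j; rewrite !inE.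
Qed.

Lemma card_perp A : #|perp A| = n - #|A|.
Proof. by have := cnt_perp A (leqnn n); rewrite cnt_full subnn cnt0; lia. Qed.

Lemma card_compl A : #|(~: A)%SET| = n - #|A|.
Proof. by have := cardsC A; rewrite card_ord; lia. Qed.

Lemma elt_bounds A i : 0 < i <= #|A| -> i <= elt A i <= n.
Proof.
move=> hi; rewrite elt_le_cnt // cnt_full; case/andP: (hi) => _ ->; rewrite andbT.
have h : i <= cnt A (elt A i) by rewrite cnt_elt.
case: (leqP (elt A i) n) => [/(cntC A)|]; first by lia.
by rewrite ltnNge elt_le_cnt // cnt_full; case/andP: hi => _ ->.
Qed.

Lemma elt_le A i : 0 < i <= #|A| -> elt A i <= n.
Proof. by case/elt_bounds/andP. Qed.

(** If the inequality failed at [x], then for [i = cnt A x] one would have [elt A i <= x] and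
    [elt B (m.+1 - i) <= n - x], with sum at most [n]. Conversely take [x = elt A j]. *)
Lemma cntP m A B : #|A| = m -> #|B| = m ->
  compatible m A B <-> (forall x, x <= n -> cnt A x + cnt B (n - x) <= m).
Proof.
move=> cA cB; split=> [h x le_xn | h j hj].
  case: (posnP (cnt A x)) => [->|ipos]; first by rewrite -cB cnt_le_card.
  have hi : 0 < cnt A x <= m by rewrite ipos -cA cnt_le_card.
  have h1 := h _ hi; have := leqnn (cnt A x); rewrite -elt_le_cnt ?cA // => h2.
  rewrite leqNgt; apply/negP => h3.
  have : m.+1 - cnt A x <= cnt B (n - x) by move: h3 hi; clear; lia.
  by rewrite -elt_le_cnt ?cB; lia.
have hn : elt A j <= n by have := @elt_bounds A j; rewrite cA => /(_ hj)/andP[].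
have := h _ hn; rewrite cnt_elt ?cA // => h1.
have : ~~ (m.+1 - j <= cnt B (n - elt A j)) by lia.
by rewrite -elt_le_cnt ?cB; lia.
Qed.

Lemma compatible_perp m A B : #|A| = m -> #|B| = m ->
  compatible m A B -> compatible (n - m) (perp B) (perp A).
Proof.
move=> cA cB /(cntP cA cB) h; apply/cntP; rewrite ?card_perp ?cA ?cB // => x le_xn.
have := cnt_perp B le_xn; have := cnt_perp A (leq_subr x n).
have := h x le_xn; rewrite cA cB subKn // => *.
by have := max_card A; rewrite cA card_ord; lia.
Qed.

(** Both sides compare in the same way with every threshold. This allows the condition on the
    annihilator to be stated through the indices that [A] misses. *)
Lemma elt_perp A i : 0 < i <= #|(~: A)%SET| ->
  elt (perp A) i = n.+1 - elt (~: A)%SET (#|(~: A)%SET|.+1 - i).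
Proof.
move=> hi; have hi' : 0 < i <= #|perp A| by rewrite card_perp -card_compl.
have hj : 0 < #|(~: A)%SET|.+1 - i <= #|(~: A)%SET| by lia.
have key x : x <= n ->
    (elt (perp A) i <= x) = (n - x < elt (~: A)%SET (#|(~: A)%SET|.+1 - i)).
  move=> le_xn; rewrite elt_le_cnt // ltnNge elt_le_cnt //.
  have := cntC A (leq_subr x n); have := cnt_perp A le_xn; have := card_compl A.
  by have := max_card A; rewrite card_ord; lia.
have /andP[b1 b2] := elt_bounds hi'; have /andP[b3 b4] := elt_bounds hj.
have := key _ b2; rewrite leqnn => /esym h1.
have : (elt (perp A) i <= n.+1 - elt (~: A)%SET (#|(~: A)%SET|.+1 - i)).
  by rewrite key; lia.
by lia.
Qed.

Lemma sum_elt A (f : nat -> nat) :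
  \sum_(1 <= i < #|A|.+1) f (elt A i) = \sum_(a in A) f a.+1.
Proof.
rewrite big_add1 /= -[RHS]big_enum /=.
transitivity (\sum_(y <- vals A) f y.+1); last by rewrite big_map.
rewrite [RHS](big_nth 0) size_vals; apply: eq_big_nat => i hi.
by rewrite eltS.
Qed.

(** The dimension of the Schubert cell of the subspaces with jumps [A] in a fixed flag, which is
    also the number of positions that [echelon_shape A] leaves open. *)
Definition inversions A : nat := \sum_(a in A) cnt (~: A)%SET a.

Lemma inversionsE A : inversions A = \sum_(1 <= i < #|A|.+1) (elt A i - i).
Proof.
rewrite /inversions -(sum_elt A (fun y => cnt (~: A)%SET y.-1)).
apply: eq_big_nat => i hi; have hi' : 0 < i <= #|A| by [].
have /andP[b1 b2] := elt_bounds hi'; have := cnt_elt_pred hi'.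
by have := @cntC A (elt A i).-1; lia.
Qed.

Lemma inversions_le A : inversions A <= #|A| * (n - #|A|).
Proof.
rewrite /inversions -sum_nat_const; apply: leq_sum => a _.
by rewrite -card_compl cnt_le_card.
Qed.

Lemma codimE l A : #|A| = l -> codim l A = l * (n - l) - inversions A.
Proof. by move=> <-; rewrite inversionsE. Qed.

Lemma elt_cover A (a : 'I_n) : a \in A ->
  exists2 i, 0 < i <= #|A| & elt A i = a.+1.
Proof.
move=> aA; have : val a \in vals A by apply: map_f; rewrite mem_enum.
case/(nthP 0) => i; rewrite size_vals => hi eq_a.
by exists i.+1; rewrite ?eltS // eq_a.
Qed.

Lemma elt_inj A B : #|A| = #|B| ->
  (forall i, 0 < i <= #|A| -> elt A i = elt B i) -> A = B.
Proof.
move=> cAB h; apply/eqP; rewrite eqEcard cAB leqnn andbT.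
apply/fintype.subsetP => a /elt_cover[i hi]; rewrite h // => eq_a.
case: i hi eq_a => // i; rewrite cAB => hi; rewrite eltS // => -[eq_a].
have : val a \in vals B by rewrite /= -eq_a mem_nth ?size_vals.
by case/mapP => b; rewrite mem_enum => bB /val_inj ->.
Qed.

(** The comparison is termwise. Its equality case makes the parameter count drop as soon as one jump
    set differs from the prescribed one. *)
Lemma inversions_mono A B : #|A| = #|B| ->
  (forall i, 0 < i <= #|A| -> elt A i <= elt B i) ->
  inversions A <= inversions B ?= iff (A == B).
Proof.
move=> cAB h; rewrite !inversionsE -cAB.
have hle : \sum_(1 <= i < #|A|.+1) (elt A i - i) <=
           \sum_(1 <= i < #|A|.+1) (elt B i - i).
  rewrite big_seq_cond [leqRHS]big_seq_cond; apply: leq_sum => i.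
  by rewrite mem_index_iota andbT => hi; apply: leq_sub2r; apply: h.
split=> //; apply/eqP/eqP => [eq_sum|-> //]; last first.
apply: elt_inj => // i hi; apply/eqP; rewrite eqn_leq h //= leqNgt.
apply/negP => lt_i; move: eq_sum; apply/eqP; rewrite neq_ltn; apply/orP; left.
rewrite !(bigD1_seq i) ?iota_uniq ?mem_index_iota //=.
rewrite -addSn; apply: leq_add.
  have /andP[b1 b2] := elt_bounds hi.
  by rewrite ltn_sub2r // (leq_ltn_trans b1).
rewrite big_seq_cond [leqRHS]big_seq_cond; apply: leq_sum => j.
by rewrite mem_index_iota => /andP[hj _]; apply: leq_sub2r; apply: h.
Qed.

(** Sums of values turn the counts of free entries into identities free of truncated subtraction;
    the doublings below avoid halving triangular numbers. *)
Definition vsum A : nat := \sum_(a in A) a.+1.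

Lemma inversions_vsum A : (inversions A).*2 + #|A| * #|A|.+1 = (vsum A).*2.
Proof.
rewrite inversionsE /vsum -(sum_elt A id).
have -> : #|A| * #|A|.+1 = (\sum_(1 <= i < #|A|.+1) i).*2.
  elim: #|A| => [|m IHm]; first by rewrite big_geq.
  by rewrite big_nat_recr //= doubleD -IHm; lia.
rewrite -doubleD -big_split /=; congr (_.*2); apply: eq_big_nat => i hi.
by rewrite subnK //; case/andP: (@elt_bounds A i hi).
Qed.

Lemma vsumC A : (vsum A).*2 + (vsum (~: A)%SET).*2 = n * n.+1.
Proof.
have -> : n * n.+1 = (\sum_(a < n) a.+1).*2.
  elim: n => [|m IHm]; first by rewrite big_ord0.
  by rewrite big_ord_recr //= doubleD -IHm; lia.
rewrite -doubleD [in RHS](bigID (mem A)) /=; congr ((_ + _).*2).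
by apply: eq_bigl => a; rewrite !inE.
Qed.

Lemma vsum_perp A : vsum (perp A) + vsum (~: A)%SET = (n - #|A|) * n.+1.
Proof.
rewrite /vsum (reindex_inj rev_ord_inj) /=.
rewrite (eq_bigl (mem (~: A)%SET)) => [|a]; last by rewrite !inE rev_ordK.
rewrite -big_split -card_compl -sum_nat_const /=; apply: eq_bigr => a _.
by have := ltn_ord a; lia.
Qed.
End Positions.

(** * Numbers of free entries of the normal forms *)

Section FreeEntries.
Local Open Scope nat_scope.
Variable n : nat.
Implicit Types (A B : {set 'I_n}) (m : nat).

Lemma compatible_bounds m A B (i : 'I_m) : #|A| = m -> #|B| = m ->
  compatible m A B -> 0 < n.+1 - elt B (m - i) <= elt A i.+1 /\ elt A i.+1 <= n.
Proof.
move=> cA cB h; have hi : 0 < i.+1 <= m by rewrite ltn_ord.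
have := h _ hi; rewrite subSS => h1.
have /andP[_ b1] : i.+1 <= elt A i.+1 <= n by apply: elt_bounds; rewrite cA.
have hj : 0 < m - i <= #|B| by rewrite cB subn_gt0 ltn_ord leq_subr.
have /andP[_ b2] := elt_bounds hj.
by lia.
Qed.

Lemma card_ord_interval (s e : nat) : s <= e <= n ->
  #|[pred j : 'I_n | s < j.+1 <= e]| = e - s.
Proof.
case/andP=> le_se le_en; apply/eqP; rewrite -(eqn_add2r s) subnK //; apply/eqP.
rewrite -[X in _ + X](sum_ord_lt (leq_trans le_se le_en)) -[RHS](sum_ord_lt le_en).
rewrite -sum1_card big_mkcond -big_split /=; apply: eq_bigr => j _.
rewrite !inE /= ltnS; case: (leqP s j) => h1; case: (ltnP j e) => h2 //=.
by move: h1 h2 le_se; lia.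
Qed.

(** Row [i] has [elt A i.+1 + elt B (m - i) - n.+1] free entries, a true difference by
    compatibility; the sum over [B] is then read backwards. *)
Lemma card_calM_free m A B : #|A| = m -> #|B| = m -> compatible m A B ->
  \sum_(i < m) #|[pred j | calM_free A B i j]| + m * n.+1 = vsum A + vsum B.
Proof.
move=> cA cB h; rewrite /vsum -(sum_elt A id) -(sum_elt B id) cA cB.
rewrite !big_add1 /= !big_mkord [X in _ = _ + X](reindex_inj rev_ord_inj) /=.
have -> : m * n.+1 = \sum_(i < m) n.+1 by rewrite sum_nat_const card_ord.
rewrite -!big_split /=; apply: eq_bigr => i _.
have [/andP[b1 b2] b3] := compatible_bounds i cA cB h.
rewrite /calM_free card_ord_interval ?b2 // -subSn // subSS.
by lia.
Qed.

Lemma mulnS_sub m : m <= n -> m * n.+1 = m * m + m * (n - m) + m.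
Proof. by move=> le_mn; rewrite -mulnDr subnKC // mulnS addnC. Qed.

Lemma codim_le m A B : #|A| = m -> #|B| = m -> compatible m A B ->
  codim m A + codim m B <= m * (n - m).
Proof.
move=> cA cB h; have := card_calM_free cA cB h.
have := inversions_vsum A; have := inversions_vsum B.
have := inversions_le A; have := inversions_le B.
rewrite (codimE cA) (codimE cB) cA cB.
have /mulnS_sub -> : m <= n by rewrite -cA -[leqRHS]card_ord max_card.
by rewrite mulnS; lia.
Qed.

Lemma card_calM_freeE m A B : #|A| = m -> #|B| = m -> compatible m A B ->
  \sum_(i < m) #|[pred j | calM_free A B i j]| =
  m * (n - m) - codim m A - codim m B.
Proof.
move=> cA cB h; have := card_calM_free cA cB h; have := codim_le cA cB h.
have := inversions_vsum A; have := inversions_vsum B.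
have := inversions_le A; have := inversions_le B.
rewrite (codimE cA) (codimE cB) cA cB.
have /mulnS_sub -> : m <= n by rewrite -cA -[leqRHS]card_ord max_card.
by rewrite mulnS; lia.
Qed.

(** The two kinds of matrices describe the same subspaces, by generators and by annihilators.
    Numerically, the changes of [vsum] under mirror image and complement make up for passing from
    [m * n.+1] to [(n - m) * n.+1]. *)
Lemma card_calM_free_perp m A B : #|A| = m -> #|B| = m -> compatible m A B ->
  \sum_(i < n - m) #|[pred j | calM_free (perp B) (perp A) i j]| =
  m * (n - m) - codim m A - codim m B.
Proof.
move=> cA cB h; rewrite -card_calM_freeE //.
have := card_calM_free cA cB h.
have := @card_calM_free (n - m) (perp B) (perp A).
rewrite !card_perp cA cB => /(_ erefl erefl (compatible_perp cA cB h)).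
have := vsum_perp A; have := vsum_perp B; have := vsumC A; have := vsumC B.
rewrite cA cB.
have le_mn : m <= n by rewrite -cA -[leqRHS]card_ord max_card.
have -> : n * n.+1 = m * n.+1 + (n - m) * n.+1 by rewrite -mulnDl subnKC.
by lia.
Qed.

End FreeEntries.

(** * As many variables as equations *)

Section Numerology.
Local Open Scope nat_scope.

Lemma sum_pairs (k : nat) (f : 'I_k.*2 -> nat) :
  \sum_t f t = \sum_(i < k) (f (idx_odd i) + f (idx_even i)).
Proof.
(* Extending [f] by 0 to all naturals frees the induction on [k] from the type of the index. *)
pose g m := if insub m is Some t then f t else 0.
have gE (t : 'I_k.*2) : f t = g t.
  by rewrite /g insubT //= => lt_t; congr f; apply: val_inj.
transitivity (\sum_(t < k.*2) g t); first by apply: eq_bigr.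
transitivity (\sum_(i < k) (g i.*2 + g i.*2.+1)); last first.
  by apply: eq_bigr => i _; rewrite !gE.
elim: k {f gE} g => [|k IHk] g; first by rewrite !big_ord0.
by rewrite doubleS !big_ord_recr /= IHk addnA.
Qed.

Lemma sum_early_last (k : nat) (hk : 0 < k) (f : 'I_k -> nat) :
  \sum_i f i = f (last_pair hk) + \sum_(i < k.-1) f (early_pair i).
Proof.
case: k hk f => // k hk f; rewrite big_ord_recr [LHS]addnC /=; congr (f _ + _).
  exact: val_inj.
by apply: eq_bigr => i _; congr f; apply: val_inj.
Qed.

Variables (n l k : nat) (hk : 0 < k) (al : 'I_k.*2 -> {set 'I_n}).
Hypothesis card_al : forall t, #|al t| = l.
Hypothesis compat : forall i, compatible l (al (idx_odd i)) (al (idx_even i)).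

Lemma nvarsE : nvars l hk al =
  \sum_(i < k) (l * (n - l) - codim l (al (idx_odd i)) - codim l (al (idx_even i))).
Proof.
rewrite (sum_early_last hk) /nvars -sum1_card big_sumType /=; congr (_ + _).
  rewrite -card_calM_freeE //.
  under [RHS]eq_bigr do rewrite -sum1_card.
  by rewrite pair_big_dep /=; apply: eq_bigl => -[i j].
under [RHS]eq_bigr do rewrite -card_calM_free_perp //.
rewrite pair_big_dep /=
  (reindex (fun p : 'I_k.-1 * 'I_(n - l) * 'I_n => (p.1.1, p.2, p.1.2))) /=; last first.
  by exists (fun p => (p.1.1, p.2, p.1.2)) => -[[]].
under [RHS]eq_bigr do rewrite -sum1_card.
rewrite pair_big_dep /=; apply: eq_bigl => -[[i j] c]; rewrite !inE.
by [].
Qed.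

Lemma sum_codims : \sum_t codim l (al t) = l * (n - l) ->
  \sum_(i < k) (l * (n - l) - codim l (al (idx_odd i)) - codim l (al (idx_even i)))
  = k.-1 * (l * (n - l)).
Proof.
rewrite sum_pairs => eq_sum.
apply/eqP; rewrite -(eqn_add2r (l * (n - l))) -mulSnr prednK // -{2}eq_sum.
have -> : k * (l * (n - l)) = \sum_(i < k) l * (n - l).
  by rewrite sum_nat_const card_ord.
rewrite -big_split /=; apply/eqP.
apply: eq_bigr => i _.
by have := codim_le (card_al _) (card_al _) (compat i); lia.
Qed.
End Numerology.

(** * Normal forms in coordinates *)

Section CoordinateFlags.
Variables (K : fieldType) (n : nat).
Implicit Types (A B : {set 'I_n}) (m p q x : nat).

Lemma mul_pid_mxE p x (M : 'M[K]_(p, n)) i j :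
  (M *m (pid_mx x : 'M_n)) i j = if (j < x)%N then M i j else 0.
Proof.
rewrite !mxE (bigD1 j) //= mxE eqxx /= big1 => [|r ne_rj].
  by case: ifP; rewrite (mulr1, mulr0) addr0.
by rewrite mxE (negPf (ne_rj : val r != val j)) mulr0.
Qed.

Lemma mul_copid_mxE p x (M : 'M[K]_(p, n)) i j :
  (M *m (copid_mx x : 'M_n)) i j = if (j < x)%N then 0 else M i j.
Proof.
rewrite /copid_mx mulmxBr mulmx1 [LHS]mxE [X in _ + X]mxE mul_pid_mxE.
by case: ifP; rewrite (subrr, subr0).
Qed.

Lemma sub_pid_mxP p x (M : 'M[K]_(p, n)) :
  reflect (forall i (j : 'I_n), (x <= j)%N -> M i j = 0) (M <= (pid_mx x : 'M_n))%MS.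
Proof.
apply: (iffP submxP) => [[D ->] i j le_xj | M0].
  by rewrite mul_pid_mxE ltnNge le_xj.
exists M; apply/matrixP => i j; rewrite mul_pid_mxE; case: ltnP => // le_xj.
exact: M0.
Qed.

Lemma sub_copid_mxP p x (M : 'M[K]_(p, n)) :
  reflect (forall i (j : 'I_n), (j < x)%N -> M i j = 0) (M <= (copid_mx x : 'M_n))%MS.
Proof.
apply: (iffP submxP) => [[D ->] i j lt_jx | M0].
  by rewrite mul_copid_mxE lt_jx.
exists M; apply/matrixP => i j; rewrite mul_copid_mxE; case: ltnP => // lt_jx.
exact: M0.
Qed.

Lemma kermx_pid_mx x : (kermx (pid_mx x : 'M[K]_n) :=: (copid_mx x : 'M[K]_n))%MS.
Proof.
apply/eqmxP/andP; split.
  apply/sub_copid_mxP => i j lt_jx; have /matrixP/(_ i j) := mulmx_ker (pid_mx x : 'M[K]_n).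
  by rewrite mul_pid_mxE lt_jx => ->; rewrite mxE.
apply/sub_kermxP/matrixP => i j; rewrite mul_pid_mxE [in RHS]mxE.
by case: ifP => // lt_jx; move: i j lt_jx; apply/sub_copid_mxP.
Qed.

Lemma kermx_copid_mx x : (kermx (copid_mx x : 'M[K]_n) :=: (pid_mx x : 'M[K]_n))%MS.
Proof.
apply/eqmxP/andP; split.
  apply/sub_pid_mxP => i j; rewrite leqNgt => /negPf ge_jx.
  have /matrixP/(_ i j) := mulmx_ker (copid_mx x : 'M[K]_n).
  by rewrite mul_copid_mxE ge_jx => ->; rewrite mxE.
apply/sub_kermxP/matrixP => i j; rewrite mul_copid_mxE [in RHS]mxE.
case: ltnP => // le_xj; move: i j le_xj; exact/sub_pid_mxP.
Qed.

(** [pid_mx x] spans the first [x] coordinate vectors and [copid_mx x] the last [n - x]. So this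
    condition and the next one are the Schubert conditions for the two opposite coordinate flags,
    imposed at every [x]. *)
Definition schubert_low p A (G : 'M[K]_(p, n)) : Prop :=
  forall x, (x <= n)%N -> (cnt A x <= \rank (G :&: (pid_mx x : 'M_n))%MS)%N.

Definition schubert_high p B (G : 'M[K]_(p, n)) : Prop :=
  forall x, (x <= n)%N -> (cnt B (n - x) <= \rank (G :&: (copid_mx x : 'M_n))%MS)%N.

(* [G] avoids the locus where its normal form in [calM A B] fails to exist or to
   be unique. *)
Definition generic m p A B (G : 'M[K]_(p, n)) : Prop :=
  forall (i : 'I_m) (v : 'rV[K]_n), (v <= G)%MS ->
    (forall j, ~~ calM_free A B i j -> v 0 j = 0) -> v = 0.

Section Annihilator.
Variables (p m : nat) (G : 'M[K]_(p, n)).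
Hypothesis rankG : \rank G = m.

(** The first [x] columns of [G] have a rank that can be computed from the kernel on either side: it
    is [m] minus one intersection dimension and [x] minus the other. Here [kermx G^T] is the
    annihilator of the row space of [G]. *)
Lemma rank_ann_pid x : (x <= n)%N ->
  (\rank (kermx G^T :&: (pid_mx x : 'M_n))%MS + m =
   x + \rank (G :&: (copid_mx x : 'M_n))%MS)%N.
Proof.
move=> le_xn; have := mxrank_mul_ker (pid_mx x : 'M[K]_n) G^T.
have -> : \rank ((pid_mx x : 'M_n) *m G^T) = \rank (G *m (pid_mx x : 'M_n)).
  by rewrite -mxrank_tr trmx_mul trmxK tr_pid_mx.
have := mxrank_mul_ker G (pid_mx x : 'M[K]_n).
rewrite (cap_eqmx (eqmx_refl G) (kermx_pid_mx x)) (capmxC (pid_mx x)) rank_pid_mx //.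
by rewrite rankG; lia.
Qed.

Lemma rank_ann_copid x : (x <= n)%N ->
  (\rank (kermx G^T :&: (copid_mx x : 'M_n))%MS + m =
   n - x + \rank (G :&: (pid_mx x : 'M_n))%MS)%N.
Proof.
move=> le_xn; have := mxrank_mul_ker (copid_mx x : 'M[K]_n) G^T.
have -> : \rank ((copid_mx x : 'M_n) *m G^T) = \rank (G *m (copid_mx x : 'M_n)).
  by rewrite -mxrank_tr trmx_mul trmxK /copid_mx linearB /= trmx1 tr_pid_mx.
have := mxrank_mul_ker G (copid_mx x : 'M[K]_n).
rewrite (cap_eqmx (eqmx_refl G) (kermx_copid_mx x)) (capmxC (copid_mx x)).
by rewrite rank_copid_mx // rankG; lia.
Qed.

Lemma schubert_low_ann A : #|A| = m ->
  schubert_high (perp A) (kermx G^T) <-> schubert_low A G.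
Proof.
move=> cA; split=> h x le_xn; have := h x le_xn; have := rank_ann_copid le_xn;
  have := cnt_perp A (leq_subr x n); rewrite subKn // cA; lia.
Qed.

Lemma schubert_high_ann B : #|B| = m ->
  schubert_low (perp B) (kermx G^T) <-> schubert_high B G.
Proof.
move=> cB; split=> h x le_xn; have := h x le_xn; have := rank_ann_pid le_xn;
  have := cnt_perp B le_xn; rewrite cB; lia.
Qed.
End Annihilator.

Section NormalForm.
Variables (m : nat) (A B : {set 'I_n}).
Hypotheses (cA : #|A| = m) (cB : #|B| = m) (cAB : compatible m A B).

Lemma elt_ltn (i j : nat) : (0 < i < j)%N -> (j <= m)%N -> (elt B i < elt B j)%N.
Proof.
move=> hij le_jm; rewrite ltnNge elt_le_cnt ?cB; last by lia.
by rewrite cnt_elt ?cB; lia.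
Qed.

(** The leading ones stand in strictly increasing columns; read in these columns, a relation between
    the rows loses its coefficients one after the other. *)
Lemma calM_row_free (M : 'M[K]_(m, n)) : calM A B M -> row_free M.
Proof.
move=> hM; rewrite -kermx_eq0; apply/rowV0P => u /sub_kermxP uM0.
apply/rowP => i; rewrite mxE.
elim/ltn_ind: {i}(i : nat) {-2}i (erefl (i : nat)) => r IHr i def_r.
have [/andP[b1 b2] b3] := compatible_bounds i cA cB cAB.
have lt_s : ((n.+1 - elt B (m - i)).-1 < n)%N by lia.
have := congr1 (fun v : 'rV_n => v 0 (Ordinal lt_s)) uM0.
rewrite !mxE (bigD1 i) //= big1 => [|j ne_ji].
  by have [_ _ h1] := hM i (Ordinal lt_s); rewrite h1 ?addr0 ?mulr1 //= prednK.
have [lt_ji|le_ij] := ltnP j i.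
  by rewrite (IHr j) ?mul0r // -def_r.
have lt_ij : (i < j)%N by rewrite ltn_neqAle le_ij eq_sym andbT.
have [h0 _ _] := hM j (Ordinal lt_s); rewrite h0 ?mulr0 //= prednK //.
have := ltn_ord j; have := @elt_ltn (m - j) (m - i).
by have := @elt_bounds _ B (m - i); rewrite cB; lia.
Qed.

(** The first [cnt A x] rows already lie in the span of the first [x] coordinate vectors; for the
    opposite flag the last [cnt B (n - x)] rows do the same service. *)
Lemma calM_schubert_low (M : 'M[K]_(m, n)) : calM A B M -> schubert_low A M.
Proof.
move=> hM x le_xn; have := calM_row_free hM => freeM.
have le_cm : (cnt A x <= m)%N by rewrite -cA cnt_le_card.
rewrite -{1}(@rank_pid_mx K m m _ le_cm le_cm) -(mxrankMfree _ freeM).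
apply: mxrankS; rewrite sub_capmx submxMl; apply/sub_pid_mxP => i j le_xj.
rewrite !mxE big1 // => r _; rewrite mxE; case: eqP => [eq_ir|]; last by rewrite mul0r.
case: ltnP => [lt_ic|]; last by rewrite mul0r.
have [_ h0 _] := hM r j; rewrite h0 ?mulr0 //.
apply: leq_ltn_trans (_ : x < _)%N => //.
by rewrite elt_le_cnt ?cA ?ltn_ord // -(val_inj eq_ir).
Qed.

Lemma calM_schubert_high (M : 'M[K]_(m, n)) : calM A B M -> schubert_high B M.
Proof.
move=> hM x le_xn; have := calM_row_free hM => freeM.
have le_cm : (cnt B (n - x) <= m)%N by rewrite -cB cnt_le_card.
rewrite -{1}(subKn le_cm) -(@rank_copid_mx K m _ (leq_subr _ _)).
rewrite -(mxrankMfree _ freeM).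
apply: mxrankS; rewrite sub_capmx submxMl; apply/sub_copid_mxP => i j lt_jx.
rewrite !mxE big1 // => r _; rewrite !mxE -[i == r]/(val i == val r).
case: eqP => [eq_ir|]; last by rewrite subrr mul0r.
case: ltnP => [|le_ci]; first by rewrite subrr mul0r.
have [h0 _ _] := hM r j; rewrite h0 ?mulr0 //.
have hr : (m - r <= cnt B (n - x))%N by rewrite -(val_inj eq_ir); lia.
have : (elt B (m - r) <= n - x)%N by rewrite elt_le_cnt ?cB //; have := ltn_ord r; lia.
by lia.
Qed.

(** All entries outside the free range are prescribed, the leading one included, so the difference
    of two [i]-th rows is a vector that [generic] forces to vanish. *)
Lemma calM_unique p (G : 'M[K]_(p, n)) (M M' : 'M[K]_(m, n)) :
  generic m A B G -> calM A B M -> calM A B M' ->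
  (M <= G)%MS -> (M' <= G)%MS -> M = M'.
Proof.
move=> gG hM hM' sM sM'; apply/eqP; rewrite -subr_eq0; apply/eqP/row_matrixP => i.
rewrite row0; apply: (gG i).
  by rewrite linearB /= addmx_sub ?eqmx_opp // (submx_trans (row_sub _ _)).
move=> j; rewrite /calM_free !mxE negb_and -leqNgt -ltnNge.
have [h1 h2 h3] := hM i j; have [h1' h2' h3'] := hM' i j.
case/orP=> [|/[dup] /h2 -> /h2' ->]; last by rewrite subrr.
rewrite leq_eqVlt => /orP[/eqP h|/[dup] /h1 -> /h1' ->]; last by rewrite subrr.
by rewrite h3 // h3' // subrr.
Qed.

(** Inside the [m]-dimensional row space of [G], the two Schubert conditions give subspaces of
    dimensions at least [i.+1] and [m - i]; they share a nonzero vector, which is scaled to become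
    row [i]. *)
Lemma calM_exists p (G : 'M[K]_(p, n)) : \rank G = m ->
  schubert_low A G -> schubert_high B G -> generic m A B G ->
  exists2 M : 'M[K]_(m, n), calM A B M & (M :=: G)%MS.
Proof.
move=> rkG lowG highG gG.
have row_ex (i : 'I_m) : exists v : 'rV[K]_n, [/\ (v <= G)%MS,
    forall j : 'I_n, (j.+1 < n.+1 - elt B (m - i))%N -> v 0 j = 0,
    forall j : 'I_n, (elt A i.+1 < j.+1)%N -> v 0 j = 0 &
    forall j : 'I_n, (j.+1 = n.+1 - elt B (m - i))%N -> v 0 j = 1].
  have [/andP[b1 b2] b3] := compatible_bounds i cA cB cAB.
  have hj : (0 < m - i <= #|B|)%N by rewrite cB subn_gt0 ltn_ord leq_subr.
  have /andP[b4 b5] := elt_bounds hj.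
  pose x := elt A i.+1; pose y := (n - elt B (m - i))%N.
  pose X := (G :&: (pid_mx x : 'M_n))%MS; pose Y := (G :&: (copid_mx y : 'M_n))%MS.
  have rX : (i.+1 <= \rank X)%N.
    by apply: leq_trans (lowG _ b3); rewrite cnt_elt ?cA ?ltn_ord.
  have rY : (m - i <= \rank Y)%N.
    by apply: leq_trans (highG _ (leq_subr _ _)); rewrite subKn // cnt_elt.
  have : (X :&: Y)%MS != 0.
    rewrite -mxrank_eq0 -lt0n; have := mxrank_sum_cap X Y.
    have : (\rank (X + Y)%MS <= m)%N.
      by rewrite -rkG mxrankS // addsmx_sub !capmxSl.
    by have := ltn_ord i; lia.
  case/rowV0Pn => v; rewrite !sub_capmx => /andP[/andP[vG vx] /andP[_ vy]] nz_v.
  have lt_s : ((n.+1 - elt B (m - i)).-1 < n)%N by lia.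
  pose c := v 0 (Ordinal lt_s).
  (* A vanishing leading entry would confine [v] to the free range of row [i]. *)
  have nz_c : c != 0.
    apply: contraNneq nz_v => c0; apply/eqP/(gG i) => // j.
    rewrite /calM_free negb_and -leqNgt -ltnNge => /orP[|lt_xj]; last first.
      by move/sub_pid_mxP: vx; apply.
    rewrite leq_eqVlt => /orP[/eqP eq_j|lt_jy].
      by rewrite -[RHS]c0; congr (v 0 _); apply: val_inj; rewrite /= -eq_j.
    by move/sub_copid_mxP: vy; apply; rewrite /y; lia.
  exists (c^-1 *: v); split=> [|j lt_j|j lt_j|j eq_j].
  - exact: scalemx_sub.
  - by rewrite mxE (sub_copid_mxP _ _ vy) ?mulr0 // /y; lia.
  - by rewrite mxE (sub_pid_mxP _ _ vx) ?mulr0.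
  rewrite mxE (_ : v 0 j = c) ?mulVf //.
  by congr (v 0 _); apply: val_inj; rewrite /= -eq_j.
have [f hf] := fin_all_exists row_ex.
pose M : 'M[K]_(m, n) := \matrix_i f i.
have hM : calM A B M.
  by move=> i j; rewrite mxE; have [_ h1 h2 h3] := hf i; split; auto.
have sMG : (M <= G)%MS by apply/row_subP => i; rewrite rowK; have [] := hf i.
exists M => //; apply/eqmxP; rewrite -(geq_leqif (mxrank_leqif_eq sMG)) rkG.
by rewrite (eqP (calM_row_free hM)).
Qed.
End NormalForm.
End CoordinateFlags.

(** * Subspaces and flags as matrices *)

Section Bridge.
Variables (K : fieldType) (n : nat).
Implicit Types (A B : {set 'I_n}) (U H : {vspace 'rV[K]_n}) (Phi : 'M[K]_n).

Definition vsmx U : 'M[K]_(\dim U, n) := \matrix_i (vbasis U)`_i.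

Lemma mem_vsmx U v : (v \in U) = (v <= vsmx U)%MS.
Proof.
apply/idP/submxP => [/coord_vbasis ->|[D ->]].
  exists (\row_i coord (vbasis U) i v); rewrite mulmx_sum_row.
  by apply: eq_bigr => i _; rewrite rowK mxE.
rewrite mulmx_sum_row; apply: memv_suml => i _; rewrite rowK memvZ //.
by apply: vbasis_mem; rewrite mem_nth ?size_tuple.
Qed.

Lemma vsmx_row_free U : row_free (vsmx U).
Proof.
rewrite -kermx_eq0; apply/rowV0P => u /sub_kermxP; rewrite mulmx_sum_row => uM0.
apply/rowP => i; rewrite mxE.
have /freeP/(_ (fun i => u 0 i)) := basis_free (vbasisP U); apply.
by rewrite -[RHS]uM0; apply: eq_bigr => j _; rewrite rowK.
Qed.

Lemma dim_rank U p (M : 'M[K]_(p, n)) :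
  (forall v, (v \in U) = (v <= M)%MS) -> \dim U = \rank M.
Proof.
move=> defU; rewrite -(eqP (vsmx_row_free U)); apply/eqmx_rank/andP; split.
  by apply/row_subP => i; rewrite -defU mem_vsmx row_sub.
by apply/row_subP => i; rewrite -mem_vsmx defU row_sub.
Qed.

Lemma mem_row_span m j (M : 'M[K]_(m, n)) v :
  (v \in row_span j M) = (v <= (pid_mx j : 'M_m) *m M)%MS.
Proof.
apply/memv_sumP/submxP => [[vs vsP ->]|[D ->]].
  have /fin_all_exists[c cP] (r : 'I_m) : exists c, (r < j)%N -> vs r = c *: row r M.
    case: (ltnP r j) => [lt_rj|]; last by exists 0.
    by have /vlineP[c ->] := vsP r lt_rj; exists c.
  exists (\row_r c r); rewrite mulmxA mulmx_sum_row big_mkcond /=.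
  apply: eq_bigr => r _; rewrite mul_pid_mxE mxE.
  by case: ifP => [/cP //|]; rewrite scale0r.
exists (fun r => D 0 r *: row r M) => [r _|]; first by rewrite memvZ ?memv_line.
rewrite mulmxA mulmx_sum_row [RHS]big_mkcond /=.
by apply: eq_bigr => r _; rewrite mul_pid_mxE; case: ifP; rewrite ?scale0r.
Qed.

Lemma mem_row_span_full m (M : 'M[K]_(m, n)) v :
  (v \in row_span m M) = (v <= M)%MS.
Proof. by rewrite mem_row_span pid_mx_1 mul1mx. Qed.

Lemma sub_mulmx_unit m p Phi (M : 'M[K]_(m, n)) (N : 'M[K]_(p, n)) :
  Phi \in unitmx -> (N <= M *m Phi)%MS = (N *m invmx Phi <= M)%MS.
Proof.
move=> uPhi; apply/idP/idP => [/(submxMr (invmx Phi))|/(submxMr Phi)].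
  by rewrite mulmxK.
by rewrite mulmxKV.
Qed.

Lemma mem_row_flag Phi x v : Phi \in unitmx -> (x <= n)%N ->
  (v \in row_flag Phi (inord x)) = (v *m invmx Phi <= (pid_mx x : 'M_n))%MS.
Proof.
by move=> uPhi le_xn; rewrite /row_flag mem_row_span inordK // sub_mulmx_unit.
Qed.

Lemma w0_unit : w0 K n \in unitmx.
Proof. exact: unitmx_perm. Qed.

Lemma mulmx_inv_w0 m (M : 'M[K]_(m, n)) i j :
  (M *m invmx (w0 K n)) i j = M i (rev_ord j).
Proof.
set s := perm (@rev_ord_inj n).
have ss1 : (s * s = 1)%g by apply/permP => r; rewrite permM !permE rev_ordK.
have -> : invmx (w0 K n) = perm_mx s^-1.
  apply: (can_inj (mulKmx w0_unit)); rewrite mulmxV ?w0_unit //.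
  by rewrite -perm_mxM mulgV perm_mx1.
by rewrite -col_permE mxE permE.
Qed.

Lemma mem_row_flag_w0 Phi x v : Phi \in unitmx -> (x <= n)%N ->
  (v \in row_flag (w0 K n *m Phi) (inord x)) =
  (v *m invmx Phi <= (copid_mx (n - x) : 'M_n))%MS.
Proof.
move=> uPhi le_xn; rewrite /row_flag mem_row_span inordK // mulmxA.
rewrite sub_mulmx_unit // sub_mulmx_unit ?w0_unit //.
apply/sub_pid_mxP/sub_copid_mxP => h i j hj.
  have := h i (rev_ord j); rewrite mulmx_inv_w0 rev_ordK; apply.
  by have := ltn_ord j; rewrite /=; lia.
by rewrite mulmx_inv_w0 h //=; have := ltn_ord j; lia.
Qed.

(** Between consecutive elements of [A] the count is constant while [r] cannot decrease, so the
    conditions at the elements imply all others. *)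
Lemma rank_cond_elt A (r : nat -> nat) : {homo r : x y / (x <= y)%N} ->
  (forall i, (1 <= i <= #|A|)%N -> (i <= r (elt A i))%N) <->
  (forall x, (x <= n)%N -> (cnt A x <= r x)%N).
Proof.
move=> mono_r; split=> [h x le_xn | h i hi].
  case: (posnP (cnt A x)) => [-> //|c_gt0].
  have hc : (1 <= cnt A x <= #|A|)%N by rewrite c_gt0 cnt_le_card.
  by apply: leq_trans (h _ hc) _; apply: mono_r; rewrite elt_le_cnt.
by have /andP[_ /h] := elt_bounds hi; rewrite cnt_elt.
Qed.

Section SchubertCoordinates.
Variables (l p : nat) (Phi : 'M[K]_n) (H : {vspace 'rV[K]_n}) (G : 'M[K]_(p, n)).
Hypotheses (uPhi : Phi \in unitmx) (defH : forall v, (v \in H) = (v <= G *m Phi)%MS).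

Lemma mem_coord v : (v \in H) = (v *m invmx Phi <= G)%MS.
Proof. by rewrite defH sub_mulmx_unit. Qed.

Lemma rank_mul_unit m (M : 'M[K]_(m, n)) : \rank (M *m Phi) = \rank M.
Proof. by rewrite mxrankMfree // row_free_unit. Qed.

Lemma dim_coord : \dim H = \rank G.
Proof. by rewrite (dim_rank defH) rank_mul_unit. Qed.

Lemma dim_cap_coord (F : {vspace 'rV[K]_n}) (E : 'M[K]_n) :
  (forall v, (v \in F) = (v *m invmx Phi <= E)%MS) ->
  \dim (H :&: F) = \rank (G :&: E)%MS.
Proof.
move=> defF; rewrite -rank_mul_unit; apply: dim_rank => v.
by rewrite memv_cap mem_coord defF sub_mulmx_unit // sub_capmx.
Qed.

Lemma schubert_lowE A : #|A| = l ->
  schubert_variety l A (row_flag Phi) H <-> \rank G = l /\ schubert_low A G.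
Proof.
move=> cA; rewrite /schubert_variety dim_coord.
pose r x := \rank (G :&: (pid_mx x : 'M[K]_n))%MS.
have mono_r : {homo r : x y / (x <= y)%N}.
  move=> x y le_xy; apply: mxrankS; rewrite capmxS //.
  by apply/sub_pid_mxP => i j le_yj; rewrite (sub_pid_mxP x _ (submx_refl _)) // (leq_trans le_xy).
rewrite /schubert_low -(rank_cond_elt A mono_r) cA; split=> -[rkG h]; split=> // i hi.
  have := h i hi; rewrite (@dim_cap_coord _ (pid_mx (elt A i))) // => v.
  by rewrite mem_row_flag //; apply: elt_le; rewrite cA.
have := h i hi; rewrite (@dim_cap_coord _ (pid_mx (elt A i))) // => v.
by rewrite mem_row_flag //; apply: elt_le; rewrite cA.
Qed.

Lemma schubert_highE B : #|B| = l ->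
  schubert_variety l B (row_flag (w0 K n *m Phi)) H <->
  \rank G = l /\ schubert_high B G.
Proof.
move=> cB; rewrite /schubert_variety dim_coord.
pose r x := \rank (G :&: (copid_mx (n - x) : 'M[K]_n))%MS.
have mono_r : {homo r : x y / (x <= y)%N}.
  move=> x y le_xy; apply: mxrankS; rewrite capmxS //.
  apply/sub_copid_mxP => i j lt_j.
  rewrite (sub_copid_mxP (n - x) _ (submx_refl _)) // (leq_trans lt_j) //.
  exact: leq_sub2l.
have -> : schubert_high B G <-> forall x, (x <= n)%N -> (cnt B x <= r x)%N.
  split=> h x le_xn; last by have := h _ (leq_subr x n); rewrite /r subKn.
  by have := h _ (leq_subr x n); rewrite /r subKn.
rewrite -(rank_cond_elt B mono_r) cB; split=> -[rkG h]; split=> // i hi.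
  have := h i hi; rewrite (@dim_cap_coord _ (copid_mx (n - elt B i))) // => v.
  by rewrite mem_row_flag_w0 //; apply: elt_le; rewrite cB.
have := h i hi; rewrite (@dim_cap_coord _ (copid_mx (n - elt B i))) // => v.
by rewrite mem_row_flag_w0 //; apply: elt_le; rewrite cB.
Qed.

End SchubertCoordinates.

(** For a point of both Schubert varieties, dimensions force such a vector when the index in [F'] is
    not lowered by one; the lowered index, which excludes the leading entry, makes it
    exceptional. *)
Definition flag_meet l (H : {vspace 'rV[K]_n}) (F F' : flag_data K n) A B : Prop :=
  exists (i : 'I_l) (v : 'rV[K]_n), [/\ v != 0, v \in H,
    v \in F (inord (elt A i.+1)) & v \in F' (inord (elt B (l - i)).-1)].

Definition killed (y : 'cV[K]_n) U : Prop := forall v, v \in U -> v *m y = 0.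

(** A nonzero functional [y] killing three subspaces witnesses that they do not span the whole
    space. This is the dual of [flag_meet], with the missing indices of [A] and [B] in place of
    their elements. *)
Definition flag_nospan m (H : {vspace 'rV[K]_n}) (F F' : flag_data K n) A B : Prop :=
  exists (i : 'I_m) (y : 'cV[K]_n), [/\ y != 0, killed y H,
    killed y (F (inord (elt (~: A)%SET i.+1))) &
    killed y (F' (inord (elt (~: B)%SET (m - i)).-1))].

Section Generic.
Variables (l p : nat) (Phi : 'M[K]_n) (H : {vspace 'rV[K]_n}) (G : 'M[K]_(p, n)).
Hypotheses (uPhi : Phi \in unitmx) (defH : forall v, (v \in H) = (v <= G *m Phi)%MS).
Variables A B : {set 'I_n}.
Hypotheses (cA : #|A| = l) (cB : #|B| = l).

Lemma generic_meet :
  ~ flag_meet l H (row_flag Phi) (row_flag (w0 K n *m Phi)) A B -> generic l A B G.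
Proof.
move=> nmeet i c cG c0; apply/eqP/negPn/negP => nz_c; apply: nmeet.
exists i, (c *m Phi).
have hi : (0 < i.+1 <= #|A|)%N by rewrite cA ltn_ord.
have hj : (0 < l - i <= #|B|)%N by rewrite cB subn_gt0 ltn_ord leq_subr.
have /andP[b1 b2] := elt_bounds hi; have /andP[b3 b4] := elt_bounds hj.
split.
- by apply: contraNneq nz_c => /(congr1 (mulmx^~ (invmx Phi))); rewrite mulmxK // mul0mx => ->.
- by rewrite defH submxMr.
- rewrite mem_row_flag // mulmxK //; apply/sub_pid_mxP => r j le_j; rewrite (ord1 r).
  by apply: c0; rewrite /calM_free negb_and; apply/orP; right; rewrite -ltnNge ltnS.
rewrite mem_row_flag_w0 ?mulmxK //; last by lia.
apply/sub_copid_mxP => r j lt_j; rewrite (ord1 r).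
by apply: c0; rewrite /calM_free negb_and -leqNgt; apply/orP; left; lia.
Qed.

Lemma generic_nospan :
  ~ flag_nospan (n - l) H (row_flag Phi) (row_flag (w0 K n *m Phi)) A B ->
  generic (n - l) (perp B) (perp A) (kermx G^T).
Proof.
move=> nspan i c cG c0; apply/eqP/negPn/negP => nz_c; apply: nspan.
(* The row [c] is a functional in the coordinates given by [Phi]; this is the same functional on the
   original space. *)
exists i, (invmx Phi *m c^T).
have hi : (0 < i.+1 <= #|(~: A)%SET|)%N by rewrite card_compl cA ltn_ord.
have hj : (0 < n - l - i <= #|(~: B)%SET|)%N.
  by rewrite card_compl cB subn_gt0 ltn_ord leq_subr.
have cAB : #|(~: A)%SET| = #|(~: B)%SET| by rewrite !card_compl cA cB.
have hj' : (0 < n - l - i <= #|(~: A)%SET|)%N by rewrite cAB.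
have hi' : (0 < i.+1 <= #|(~: B)%SET|)%N by rewrite -cAB.
have /andP[b1 b2] := elt_bounds hi; have /andP[b3 b4] := elt_bounds hj.
have key (v : 'rV_n) : (forall j, v 0 j = 0 \/ c 0 j = 0) -> v *m c^T = 0.
  move=> h; apply/matrixP => r s; rewrite (ord1 r) (ord1 s) !mxE big1 // => j _.
  by rewrite mxE; case: (h j) => ->; rewrite (mul0r, mulr0).
split.
- apply: contraNneq nz_c => /(congr1 (mulmx Phi)).
  by rewrite mulmxA mulmxV // mul1mx mulmx0 => /eqP; rewrite trmx_eq0.
- move=> v; rewrite (mem_coord uPhi defH) mulmxA => /submxP[D ->].
  rewrite -mulmxA; have -> : G *m c^T = 0; last by rewrite mulmx0.
  by apply: trmx_inj; rewrite trmx_mul trmxK trmx0; apply/sub_kermxP.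
- move=> v; rewrite mem_row_flag // mulmxA => /sub_pid_mxP v0; apply: key => j.
  case: (leqP (elt (~: A)%SET i.+1) j) => [/(v0 0)|lt_j]; [by left|right].
  apply: c0; rewrite /calM_free negb_and -leqNgt; apply/orP; left.
  rewrite elt_perp // card_compl cA.
  have -> : ((n - l).+1 - (n - l - i) = i.+1)%N by have := ltn_ord i; lia.
  by lia.
move=> v; rewrite mem_row_flag_w0 // ?mulmxA; last by lia.
move=> /sub_copid_mxP v0; apply: key => j.
case: (ltnP j (n - (elt (~: B)%SET (n - l - i)).-1)) => [/(v0 0)|le_j]; [by left|right].
apply: c0; rewrite /calM_free negb_and -ltnNge; apply/orP; right.
rewrite elt_perp // card_compl cB subSS.
by lia.
Qed.

End Generic.
End Bridge.

(** * Dimension counting by polynomial maps *)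

Section Kronecker.
Local Open Scope nat_scope.

Lemma base_expansion_inj (n b : nat) (f g : 'I_n -> nat) :
  (forall i, f i < b) -> (forall i, g i < b) ->
  \sum_i f i * b ^ i = \sum_i g i * b ^ i -> f =1 g.
Proof.
elim: n f g => [|n IHn] f g fb gb; first by move=> _ [].
have expand (h : 'I_n.+1 -> nat) :
    \sum_i h i * b ^ i = (\sum_(i < n) h (lift ord0 i) * b ^ i) * b + h ord0.
  rewrite big_ord_recl muln1 addnC; congr (_ + _).
  by rewrite big_distrl; apply: eq_bigr => i _; rewrite /= expnSr mulnA.
have b_gt0 : 0 < b by apply: leq_ltn_trans (fb ord0).
rewrite !expand => eq_fg.
have := congr1 (modn^~ b) eq_fg; rewrite /= !modnMDl !modn_small // => eq0.
have := congr1 (divn^~ b) eq_fg; rewrite /= !divnMDl // !divn_small // !addn0.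
move/(IHn _ _ (fun=> fb _) (fun=> gb _)) => eqS i.
by case: (unliftP ord0 i) => [j|] ->.
Qed.
End Kronecker.

Lemma mnm_leq_mdeg (n : nat) (m : 'X_{1..n}) (i : 'I_n) : (m i <= mdeg m)%N.
Proof. by rewrite mdegE (bigD1 i) //= leq_addr. Qed.

(* Kronecker substitution: [t ^ (b ^ i)] for the [i]-th variable separates the
   monomials of [p], so that a nonzero polynomial in [t] results. *)
Lemma mpoly_nonroot (K : numFieldType) (n : nat) (p : {mpoly K[n]}) :
  p != 0 -> exists x : 'I_n -> K, p.@[x] != 0.
Proof.
move=> nz_p; pose b := msize p; pose w (m : 'X_{1..n}) := (\sum_i m i * b ^ i)%N.
have ltb m : m \in msupp p -> forall i, (m i < b)%N.
  by move=> mp i; apply: leq_ltn_trans (mnm_leq_mdeg _ _) (msize_mdeg_lt mp).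
pose P : {poly K} := \sum_(m <- msupp p) p@_m *: 'X^(w m).
have evalP t : P.[t] = p.@[fun i => t ^+ (b ^ i)].
  rewrite horner_sum mevalE; apply: eq_bigr => m _.
  rewrite hornerZ hornerXn; congr (_ * _).
  by rewrite -prodrXr; apply: eq_bigr => i _; rewrite -exprM mulnC.
have nz_P : P != 0.
  have [m mp] : exists m, m \in msupp p.
    have : msupp p != [::] by rewrite msupp_eq0.
    by case: (msupp p) => // m s _; exists m; rewrite mem_head.
  apply/eqP => /polyP/(_ (w m)); rewrite coef0 coef_sum (bigD1_seq m) ?msupp_uniq //=.
  rewrite coefZ coefXn eqxx mulr1 big_seq_cond big1 ?addr0 => [/eqP|r].
    by apply/negP; rewrite -mcoeff_msupp.
  case/andP=> rp ne_rm; rewrite coefZ coefXn; case: eqP => [eq_w|]; last by rewrite mulr0.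
  case/eqP: ne_rm; apply/mnmP.
  exact: (base_expansion_inj (ltb _ rp) (ltb _ mp) (esym eq_w)).
have [t nroot] : exists t, P.[t] != 0.
  pose s : seq K := [seq i%:R | i <- iota 0 (size P)].
  have uniq_s : uniq s by rewrite map_inj_uniq ?iota_uniq // => i j /eqP; rewrite eqr_nat => /eqP.
  have : ~~ all (root P) s.
    by apply/negP => /(max_poly_roots nz_P)/(_ uniq_s); rewrite size_map size_iota ltnn.
  by case/allPn => t _; exists t.
by exists (fun i => t ^+ (b ^ i)); rewrite -evalP.
Qed.

Section Dependence.
Variable K : fieldType.

Lemma msizeM_leq n (p q : {mpoly K[n]}) d e :
  (msize p <= d.+1)%N -> (msize q <= e.+1)%N -> (msize (p * q) <= (d + e).+1)%N.
Proof.
move=> hp hq; have [->|nz_p] := eqVneq p 0; first by rewrite mul0r msize0.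
have [->|nz_q] := eqVneq q 0; first by rewrite mulr0 msize0.
rewrite msizeM // -subn1 leq_subLR; apply: leq_trans (leq_add hp hq) _.
by rewrite addSn addnS add1n.
Qed.

Lemma msizeX_leq n (p : {mpoly K[n]}) d e :
  (msize p <= d.+1)%N -> (msize (p ^+ e) <= (e * d).+1)%N.
Proof.
move=> hp; elim: e => [|e IHe]; first by rewrite expr0 msize1.
by rewrite exprS mulSn msizeM_leq.
Qed.

Lemma msize_prod_leq n b (q : 'I_b -> {mpoly K[n]}) d :
  (forall i, msize (q i) <= d.+1)%N -> (msize (\prod_i q i) <= (b * d).+1)%N.
Proof.
elim: b q => [|b IHb] q hq; first by rewrite big_ord0 msize1.
by rewrite big_ord_recl mulSn msizeM_leq // IHb.
Qed.

(* Counting: the monomials of degree at most [N] in each [q i] are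
   [(N + 1) ^ b] many and lie in a space of dimension [O(N ^ a)]. *)
Lemma algebraic_dependence a b (q : 'I_b -> {mpoly K[a]}) : (a < b)%N ->
  exists2 p : {mpoly K[b]}, p != 0 & p \mPo [tuple q i | i < b] = 0.
Proof.
move=> lt_ab; pose e := \max_i msize (q i).
have qe i : (msize (q i) <= e.+1)%N by apply: leqW; exact: (leq_bigmax i).
(* [D] bounds the degree of a product of powers of the [q i] with exponents at most [N]. As
   [D.+1 <= c.+1 * N.+1], the [a]-th power of [D.+1] is at most [N] times that of [N.+1], which is
   less than [N.+1 ^ a.+1]; this dictates the choice of [N]. *)
pose c := (b * e)%N; pose N := (c.+1 ^ a)%N; pose D := (b * (N * e))%N.
pose S := {ffun 'I_b -> 'I_N.+1}; pose T := {ffun 'I_a -> 'I_D.+1}.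
pose mS (s : S) : 'X_{1..b} := [multinom val (s i) | i < b].
pose mT (t : T) : 'X_{1..a} := [multinom val (t i) | i < a].
have lt_card : (#|T| < #|S|)%N.
  rewrite !card_ffun !card_ord.
  have le_D : (D.+1 <= c.+1 * N.+1)%N by rewrite /D /c; nia.
  have le_Da : (D.+1 ^ a <= (c.+1 * N.+1) ^ a)%N.
    by case: (a) => // a1; rewrite leq_exp2r.
  have le_Nb : (N.+1 ^ a.+1 <= N.+1 ^ b)%N by rewrite leq_pexp2l.
  apply: leq_ltn_trans le_Da (leq_trans _ le_Nb).
  by rewrite expnMn -/N expnS ltn_pmul2r ?expn_gt0.
pose Q (s : S) := \prod_i q i ^+ s i.
pose M := \matrix_(i < #|S|, j < #|T|) (Q (enum_val i))@_(mT (enum_val j)).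
have : kermx M != 0.
  by rewrite kermx_eq0 /row_free neq_ltn (leq_ltn_trans (rank_leq_col M)).
case/rowV0Pn => u /sub_kermxP uM0 nz_u.
pose p := \sum_(s : S) u 0 (enum_rank s) *: 'X_[mS s].
have coefp s : p@_(mS s) = u 0 (enum_rank s).
  rewrite raddf_sum /= (bigD1 s) //= mcoeffZ mcoeffX eqxx mulr1 big1 ?addr0 // => r ne_rs.
  rewrite mcoeffZ mcoeffX; case: eqP => [/mnmP eq_m|]; last by rewrite mulr0.
  case/eqP: ne_rs; apply/ffunP => i; apply: val_inj.
  by have := eq_m i; rewrite !mnmE.
exists p.
  apply: contraNneq nz_u => p0; apply/eqP/rowP => i; rewrite mxE.
  by rewrite -(enum_valK i) -coefp p0 mcoeff0.
have compE : p \mPo [tuple q i | i < b] = \sum_s u 0 (enum_rank s) *: Q s.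
  rewrite raddf_sum /=; apply: eq_bigr => s _; rewrite comp_mpolyZ comp_mpolyX.
  by congr (_ *: _); apply: eq_bigr => i _; rewrite tnth_mktuple mnmE.
rewrite compE; apply/mpolyP => m; rewrite mcoeff0 raddf_sum /=.
have [small|big] := boolP [forall i, m i < D.+1]%N; last first.
  rewrite big1 // => s _; rewrite mcoeffZ memN_msupp_eq0 ?mulr0 //.
  apply: msize_mdeg_ge; case/forallPn: big => i; rewrite -leqNgt => le_Dm.
  apply: leq_trans _ (leq_trans le_Dm (mnm_leq_mdeg _ _)).
  apply: msize_prod_leq => j; apply: leq_trans (msizeX_leq _ (qe j)) _.
  by rewrite ltnS leq_mul2r -ltnS ltn_ord orbT.
pose t : T := [ffun i => inord (m i)].
have <- : mT t = m.
  by apply/mnmP => i; rewrite mnmE ffunE; apply: inordK; apply: (forallP small).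
have := congr1 (fun v : 'rV_#|T| => v 0 (enum_rank t)) uM0.
rewrite !mxE => uM0t; rewrite -[RHS]uM0t (reindex _ (onW_bij _ (enum_val_bij S))) /=.
by apply: eq_bigr => i _; rewrite mcoeffZ mxE enum_valK enum_rankK.
Qed.

End Dependence.

(** * Thin sets and images of polynomial maps *)

Section PolynomialFunctions.
Variable K : fieldType.
Implicit Types J T : finType.

Definition peval J (p : {mpoly K[#|J|]}) (x : J -> K) : K :=
  p.@[fun v => x (enum_val v)].

(** Being polynomial is a property of functions here, with variables named by a finite type, so that
    the entries of a matrix product can be treated without writing polynomials down. *)
Definition polyfun J (f : (J -> K) -> K) : Prop :=
  exists p, forall x, f x = peval p x.

Lemma polyfun_const J c : polyfun (fun _ : J -> K => c).
Proof. by exists c%:MP => x; rewrite /peval mevalC. Qed.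

Lemma polyfun_coord J (j : J) : polyfun (fun x => x j).
Proof. by exists 'X_(enum_rank j) => x; rewrite /peval mevalXU enum_rankK. Qed.

Lemma polyfunD J (f g : (J -> K) -> K) :
  polyfun f -> polyfun g -> polyfun (fun x => f x + g x).
Proof. by move=> [p fE] [q gE]; exists (p + q) => x; rewrite fE gE /peval mevalD. Qed.

Lemma polyfunM J (f g : (J -> K) -> K) :
  polyfun f -> polyfun g -> polyfun (fun x => f x * g x).
Proof. by move=> [p fE] [q gE]; exists (p * q) => x; rewrite fE gE /peval mevalM. Qed.

Lemma polyfun_sum J (I : finType) (r : seq I) (P : pred I) (f : I -> (J -> K) -> K) :
  (forall i, polyfun (f i)) -> polyfun (fun x => \sum_(i <- r | P i) f i x).
Proof.
move=> /fin_all_exists[p fE]; exists (\sum_(i <- r | P i) p i) => x.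
by rewrite /peval raddf_sum; apply: eq_bigr => i _; rewrite fE.
Qed.

Lemma polyfun_prod J (I : finType) (r : seq I) (P : pred I) (f : I -> (J -> K) -> K) :
  (forall i, polyfun (f i)) -> polyfun (fun x => \prod_(i <- r | P i) f i x).
Proof.
move=> /fin_all_exists[p fE]; exists (\prod_(i <- r | P i) p i) => x.
by rewrite /peval rmorph_prod; apply: eq_bigr => i _; rewrite fE.
Qed.

Lemma polyfun_comp J T (f : (J -> K) -> T -> K) (p : {mpoly K[#|T|]}) :
  (forall t, polyfun (fun x => f x t)) -> polyfun (fun x => peval p (f x)).
Proof.
move=> /fin_all_exists[q fE].
exists (p \mPo [tuple q (enum_val i) | i < #|T|]) => x.
rewrite /peval comp_mpoly_meval; apply: meval_eq => v.
by rewrite tnth_mktuple fE.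
Qed.

(** This stands for having dimension less than [#|T|]: containment in the zero set of one nonzero
    polynomial. *)
Definition thin T (B : (T -> K) -> Prop) : Prop :=
  exists2 p : {mpoly K[#|T|]}, p != 0 & forall x, B x -> peval p x = 0.

Lemma thin_sub T (B B' : (T -> K) -> Prop) :
  (forall x, B x -> B' x) -> thin B' -> thin B.
Proof. by move=> sBB' [p nz_p p0]; exists p => // x /sBB'/p0. Qed.

Lemma thin_union T (I : finType) (B : I -> (T -> K) -> Prop) :
  (forall i, thin (B i)) -> thin (fun x => exists i, B i x).
Proof.
move=> hB; have /fin_all_exists[p hp] i : exists p : {mpoly K[#|T|]},
    p != 0 /\ forall x, B i x -> peval p x = 0.
  by have [p nz_p p0] := hB i; exists p.
exists (\prod_i p i); first by apply/prodf_neq0 => i _; have [] := hp i.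
move=> x [i Bx]; rewrite /peval rmorph_prod (bigD1 i) //=.
by have [_ /(_ x Bx)] := hp i; rewrite /peval => ->; rewrite mul0r.
Qed.

(** With the parameters outside [S] set to 0, the components of [f] are more polynomials than there
    are variables; an algebraic relation between them vanishes on the image. *)
Lemma thin_image J T (f : (J -> K) -> T -> K) (S : {set J}) :
  (forall t, polyfun (fun x => f x t)) -> (#|S| < #|T|)%N ->
  thin (fun y => exists2 x, (forall j, j \notin S -> x j = 0) & y =1 f x).
Proof.
move=> /fin_all_exists[q fE] lt_ST.
(* The inclusion of the coordinate subspace: a variable for an index in [S], and 0 for any other. *)
pose s (v : 'I_#|J|) : {mpoly K[#|S|]} :=
  \sum_w (enum_val w == enum_val v :> J)%:R *: 'X_w.
pose Q (t : 'I_#|T|) := q (enum_val t) \mPo [tuple s v | v < #|J|].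
have [p nz_p p0] := algebraic_dependence Q lt_ST.
exists p => // y [x x0 eq_y].
have := congr1 (meval (fun w => x (enum_val w))) p0.
rewrite meval0 comp_mpoly_meval => pQ0; rewrite -[RHS]pQ0; apply: meval_eq => t.
rewrite tnth_mktuple eq_y fE /Q comp_mpoly_meval; apply: meval_eq => v.
rewrite tnth_mktuple raddf_sum /=.
have [vS|vS] := boolP (enum_val v \in S); last first.
  rewrite x0 // big1 // => w _; rewrite mevalZ; case: eqP => [eq_w|]; last by rewrite mul0r.
  by rewrite -eq_w enum_valP in vS.
rewrite (bigD1 (enum_rank_in vS (enum_val v))) //= enum_rankK_in // eqxx scale1r.
rewrite mevalXU enum_rankK_in // big1 ?addr0 // => w ne_w.
rewrite mevalZ; case: eqP => [eq_w|]; last by rewrite mul0r.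
by case/eqP: ne_w; apply: enum_val_inj; rewrite enum_rankK_in.
Qed.

End PolynomialFunctions.

(** * Jumps of a subspace in a flag *)

Section JumpSets.
Variables (K : fieldType) (n : nat).
Implicit Types (D : {set 'I_n}) (N : 'M[K]_n).

Definition coord_mx D : 'M[K]_(#|D|, n) := \matrix_(i, j) (j == enum_val i)%:R.

Lemma coord_mx_tr D : coord_mx D *m (coord_mx D)^T = 1%:M.
Proof.
apply/matrixP => i j; rewrite !mxE (bigD1 (enum_val i)) //= !mxE eqxx mul1r.
rewrite big1 ?addr0 => [|k ne_k]; first by rewrite (inj_eq enum_val_inj).
by rewrite mxE (negPf ne_k) mul0r.
Qed.

Lemma row_free_coord_mx D : row_free (coord_mx D).
Proof. by apply/row_freeP; exists (coord_mx D)^T; apply: coord_mx_tr. Qed.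

Lemma sub_coord_mxP D m (M : 'M[K]_(m, n)) :
  reflect (forall i j, j \notin D -> M i j = 0) (M <= coord_mx D)%MS.
Proof.
apply: (iffP submxP) => [[u ->] i j jD|M0].
  rewrite mxE big1 // => k _; rewrite mxE; case: eqP => [eq_j|]; last by rewrite mulr0.
  by rewrite eq_j enum_valP in jD.
exists (M *m (coord_mx D)^T); apply/matrixP => i j; rewrite mxE.
have [jD|jD] := boolP (j \in D); last first.
  rewrite M0 // big1 // => k _; rewrite !mxE; case: eqP => [eq_j|]; last by rewrite mulr0.
  by rewrite eq_j enum_valP in jD.
have coefE k : (M *m (coord_mx D)^T) i k = M i (enum_val k).
  rewrite mxE (bigD1 (enum_val k)) //= !mxE eqxx mulr1 big1 ?addr0 // => r ne_r.
  by rewrite !mxE (negPf ne_r) mulr0.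
rewrite (bigD1 (enum_rank_in jD j)) //= coefE enum_rankK_in // mxE enum_rankK_in //.
rewrite eqxx mulr1 big1 ?addr0 // => k ne_k; rewrite [coord_mx D k j]mxE.
case: eqP => [eq_j|]; last by rewrite mulr0.
by case/eqP: ne_k; apply: enum_val_inj; rewrite enum_rankK_in.
Qed.

Lemma row_coord_mx D (M : 'M[K]_n) (i : 'I_#|D|) j :
  (coord_mx D *m M) i j = M (enum_val i) j.
Proof.
rewrite mxE (bigD1 (enum_val i)) //= mxE eqxx mul1r big1 ?addr0 // => r ne_r.
by rewrite mxE (negPf ne_r) mul0r.
Qed.

(** The rows of [1 + N] with index in [D] are then in reduced echelon form with pivots at their last
    nonzero entries, so [D] is the set of jumps of their span in the coordinate flag; the other rows
    are those of the identity. *)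
Definition echelon_shape D N : Prop :=
  forall i j : 'I_n, ~~ [&& i \in D, j \notin D & (j < i)%N] -> N i j = 0.

Section Shape.
Variables (D : {set 'I_n}) (N : 'M[K]_n).
Hypothesis shapeN : echelon_shape D N.

(** An open position leads from a row in [D] to a column outside [D], so two of them never compose.
    Hence [1 - N] inverts [1 + N], and inversion stays polynomial in the parameters. *)
Lemma shape_mulmx : N *m N = 0.
Proof.
apply/matrixP => i j; rewrite !mxE big1 // => k _.
have [kD|kD] := boolP (k \in D); first by rewrite shapeN ?mul0r // kD andbF.
by rewrite [N k j]shapeN ?mulr0 // (negPf kD).
Qed.

Lemma shape_mul_inv : (1%:M - N) *m (1%:M + N) = 1%:M.
Proof. by rewrite mulmxBl !mulmxDr !mul1mx mulmx1 shape_mulmx addr0 addrK. Qed.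

Lemma shape_inv_mul : (1%:M + N) *m (1%:M - N) = 1%:M.
Proof. exact: mulmx1C shape_mul_inv. Qed.

Lemma shape_unit : 1%:M + N \in unitmx.
Proof. by case: (mulmx1_unit shape_mul_inv). Qed.

Lemma mulmx_shape_in m (M : 'M[K]_(m, n)) i j : j \in D ->
  (M *m (1%:M + N)) i j = M i j.
Proof.
move=> jD; rewrite mulmxDr mulmx1 mxE [X in _ + X]mxE big1 ?addr0 // => k _.
by rewrite shapeN ?mulr0 // jD andbF.
Qed.

(** The coefficients of a vector on the echelon rows are its entries at the pivots, so a vector that
    vanishes from [x] on uses only pivots below [x]. *)
Lemma sub_shape_pid m (M : 'M[K]_(m, n)) x : (M <= coord_mx D *m (1%:M + N))%MS ->
  (M <= (pid_mx x : 'M_n))%MS ->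
  (M *m (1%:M - N) <= coord_mx [set j in D | (j < x)%N]%SET)%MS.
Proof.
case/submxP=> u -> /sub_pid_mxP M0; rewrite -!mulmxA shape_inv_mul mulmx1.
have uD : (u *m coord_mx D <= coord_mx D)%MS by apply: submxMl.
apply/sub_coord_mxP => i j; rewrite inE negb_and.
have [jD /= le_xj|jD _] := boolP (j \in D); last exact: (sub_coord_mxP _ _ uD).
by rewrite -(mulmx_shape_in _ _ jD) -mulmxA M0 // leqNgt.
Qed.

Lemma rank_cap_shape x :
  (\rank ((coord_mx D *m (1%:M + N)) :&: (pid_mx x : 'M_n))%MS <= cnt D x)%N.
Proof.
set X := (_ :&: _)%MS.
have /mxrankS : (X *m (1%:M - N) <= coord_mx [set j in D | (j < x)%N]%SET)%MS.
  by apply: sub_shape_pid; [apply: capmxSl|apply: capmxSr].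
rewrite (eqP (row_free_coord_mx _)) mxrankMfree // row_free_unit.
by case: (mulmx1_unit shape_mul_inv).
Qed.

End Shape.

(** The pivots are the positions of last nonzero entries of vectors of the row space. They are
    defined by an existential, decided classically through [asbool]. *)
Lemma echelon_exists p (G : 'M[K]_(p, n)) :
  exists D N, echelon_shape D N /\ (coord_mx D *m (1%:M + N) :=: G)%MS.
Proof.
pose lead (r : 'I_n) (v : 'rV[K]_n) :=
  [/\ (v <= G)%MS, v 0 r = 1 & forall j : 'I_n, (r < j)%N -> v 0 j = 0].
pose D := [set r | boolp.asbool (exists v, lead r v)]%SET.
have inD (r : 'I_n) : r \in D <-> exists v, lead r v.
  by rewrite inE; split=> [/boolp.asboolP|h]; [|apply/boolp.asboolP].
have red (r : 'I_n) : exists v : 'rV[K]_n, r \in D -> lead r v /\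
    forall j, j \in D -> j != r -> v 0 j = 0.
  elim/ltn_ind: {r}(r : nat) {-2}r (erefl (r : nat)) => m IHm r def_r.
  have [rD|] := boolP (r \in D); last by exists 0.
  have [w [wG wr wz]] := (inD r).1 rD.
  have /fin_all_exists[f fP] (j : 'I_n) : exists v : 'rV[K]_n, (j < r)%N -> j \in D ->
      lead j v /\ forall k, k \in D -> k != j -> v 0 k = 0.
    case: (ltnP j r) => [lt_jr|_]; last by exists 0.
    by rewrite def_r in lt_jr; have [v hv] := IHm _ lt_jr j erefl; exists v => _ /hv.
  pose P (j : 'I_n) := (j < r)%N && (j \in D).
  (* Subtracting the reduced rows of smaller pivots clears those pivots; larger pivots lie beyond
     the last nonzero entry. *)
  exists (w - \sum_(j | P j) w 0 j *: f j) => _.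
  have coefE k : (w - \sum_(j | P j) w 0 j *: f j) 0 k =
      w 0 k - \sum_(j | P j) w 0 j * f j 0 k.
    by rewrite !mxE summxE; congr (_ - _); apply: eq_bigr => j _; rewrite mxE.
  split; first split.
  - rewrite addmx_sub // eqmx_opp summx_sub // => j /andP[lt_jr jD].
    by have [[fG _ _] _] := fP j lt_jr jD; rewrite scalemx_sub.
  - rewrite coefE wr big1 ?subr0 // => j /andP[lt_jr jD].
    by have [[_ _ h0] _] := fP j lt_jr jD; rewrite h0 ?mulr0.
  - move=> k lt_rk; rewrite coefE wz // big1 ?subr0 // => j /andP[lt_jr jD].
    by have [[_ _ h0] _] := fP j lt_jr jD; rewrite h0 ?mulr0 // (ltn_trans lt_jr).
  move=> k kD ne_kr; rewrite coefE.
  have [lt_rk|le_kr] := ltnP r k.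
    rewrite wz // big1 ?subr0 // => j /andP[lt_jr jD].
    by have [[_ _ h0] _] := fP j lt_jr jD; rewrite h0 ?mulr0 // (ltn_trans lt_jr).
  have lt_kr : (k < r)%N by rewrite ltn_neqAle ne_kr.
  rewrite (bigD1 k) /= ?/P ?lt_kr //.
  have [[_ -> _] _] := fP k lt_kr kD; rewrite mulr1 big1 ?addr0 ?subrr //.
  move=> j /andP[/andP[lt_jr jD] ne_jk].
  by have [_ h0] := fP j lt_jr jD; rewrite h0 ?mulr0 // eq_sym.
have [f fP] := fin_all_exists red.
pose N : 'M[K]_n := \matrix_(r, j) if r \in D then f r 0 j - (r == j)%:R else 0.
have rowN r : r \in D -> row r (1%:M + N) = f r.
  by move=> rD; apply/rowP => j; rewrite !mxE rD addrC subrK.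
exists D, N; split.
  move=> i j; rewrite mxE; case: ifP => //= iD.
  have [[fG f1 f0] fD] := fP i iD.
  have [<- _|ne_ij] := eqVneq i j; first by rewrite f1 subrr.
  rewrite negb_and negbK subr0 => /orP[jD|]; first by rewrite fD // eq_sym.
  by rewrite -leqNgt leq_eqVlt (negPf (ne_ij : val i != val j)) => /f0.
apply/eqmxP/andP; split.
  apply/row_subP => i; rewrite (_ : row i _ = row (enum_val i) (1%:M + N)).
    by rewrite rowN ?enum_valP //; have [[]] := fP _ (enum_valP i).
  by apply/rowP => j; rewrite [LHS]mxE [RHS]mxE row_coord_mx.
apply/row_subP => i; set v := row i G.
have vG : (v <= G)%MS by apply: row_sub.
pose c : 'rV[K]_n := \row_j if j \in D then v 0 j else 0.
have cD : (c <= coord_mx D)%MS.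
  by apply/sub_coord_mxP => r j /negPf jD; rewrite mxE jD.
suff -> : v = c *m (1%:M + N) by rewrite submxMr.
have cE : c *m (1%:M + N) = \sum_(r in D) v 0 r *: f r.
  rewrite mulmx_sum_row [RHS]big_mkcond; apply: eq_bigr => r _; rewrite mxE.
  by case: ifP => [rD|]; rewrite ?scale0r // rowN.
apply/eqP; rewrite -subr_eq0; set u := _ - _.
have uG : (u <= G)%MS.
  rewrite /u cE addmx_sub // eqmx_opp summx_sub // => r rD.
  by have [[fG _ _] _] := fP r rD; rewrite scalemx_sub.
have uD r : r \in D -> u 0 r = 0.
  have -> : u 0 r = v 0 r - \sum_(k in D) v 0 k * f k 0 r.
    rewrite /u cE; move: (v) => v'; rewrite !mxE summxE; congr (_ - _).
    by apply: eq_bigr => k _; rewrite mxE.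
  move=> rD; rewrite (bigD1 r) //=.
  have [[_ -> _] _] := fP r rD; rewrite mulr1 big1 ?addr0 ?subrr // => k /andP[kD ne_kr].
  by have [_ h0] := fP k kD; rewrite h0 ?mulr0 // eq_sym.
(* The last nonzero position of [u] would be a pivot, and [u] vanishes at all pivots. *)
apply: contraT => /eqP nz_u.
have [r0 nz_r0] : exists r, u 0 r != 0.
  by apply/existsP; apply: contraT => /existsPn h; case: nz_u; apply/rowP => r;
    rewrite [RHS]mxE; apply/eqP/negPn/h.
have [r nz_r max_r] := @arg_maxnP _ r0 (fun r => u 0 r != 0) val nz_r0.
case/eqP: (nz_r); apply: uD; apply/inD; exists ((u 0 r)^-1 *: u); split.
- exact: scalemx_sub.
- by rewrite mxE mulVf.
move=> j lt_rj; rewrite mxE; apply/eqP; rewrite mulf_eq0; apply/orP; right.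
by apply: contraLR lt_rj => /max_r; rewrite -leqNgt.
Qed.

End JumpSets.

(** * Linear relations between rows of two matrices *)

Section Relations.
Variable K : fieldType.

(** A square matrix with a kernel on one side has one on the other; the parametrization can only use
    a dependence between rows. *)
Lemma square_kernel (U V : finType) (R : {set U}) (C : {set V})
    (F : U -> V -> K) (y : V -> K) : #|R| = #|C| ->
  (exists2 j, j \in C & y j != 0) ->
  (forall r, r \in R -> \sum_(j in C) F r j * y j = 0) ->
  exists2 c : U -> K, (exists z, c z != 0) /\ (forall r, r \notin R -> c r = 0) &
    forall j, j \in C -> \sum_r c r * F r j = 0.
Proof.
move=> cRC [j0 j0C nz_y] Fy.
pose M : 'M[K]_(#|R|, #|C|) := \matrix_(i, j) F (enum_val i) (enum_val j).
pose Y : 'cV[K]_#|C| := \col_j y (enum_val j).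
have MY0 : M *m Y = 0.
  apply/colP => i; rewrite !mxE -[RHS](Fy _ (enum_valP i)) [RHS]big_enum_val.
  by apply: eq_bigr => j _; rewrite !mxE.
have nfree : ~~ row_free M.
  apply: contraNN nz_y => /eqP rkM.
  have freeM : row_free M^T by rewrite /row_free mxrank_tr rkM cRC.
  have : Y^T == 0.
    by rewrite -(mulmx_free_eq0 _ freeM) -trmx_mul MY0 trmx0.
  rewrite trmx_eq0 => /eqP/colP/(_ (enum_rank_in j0C j0)).
  by rewrite !mxE enum_rankK_in // => ->.
rewrite -kermx_eq0 in nfree; have /rowV0Pn[u /sub_kermxP uM0 nz_u] := nfree.
pose c r := \sum_i (enum_val i == r)%:R * u 0 i.
have cE i : c (enum_val i) = u 0 i.
  rewrite /c (bigD1 i) //= eqxx mul1r big1 ?addr0 // => k ne_ki.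
  by rewrite (inj_eq enum_val_inj) (negPf ne_ki) mul0r.
exists c; first split.
- have [i nz_i] : exists i, u 0 i != 0.
    apply/existsP; apply: contraR nz_u => /existsPn h; apply/eqP/rowP => i.
    by rewrite [RHS]mxE; apply/eqP/negPn/h.
  by exists (enum_val i); rewrite cE.
- move=> r rR; rewrite /c big1 // => i _; case: eqP => [eq_r|]; last by rewrite mul0r.
  by rewrite -eq_r enum_valP in rR.
move=> j jC; have := congr1 (fun v : 'rV_#|C| => v 0 (enum_rank_in jC j)) uM0.
rewrite !mxE => uMj; rewrite -[RHS]uMj.
under eq_bigr do rewrite /c mulr_suml.
rewrite exchange_big /=; apply: eq_bigr => i _; rewrite mxE enum_rankK_in //.
rewrite (bigD1 (enum_val i)) //= eqxx mul1r big1 ?addr0 // => r ne_r.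
by rewrite eq_sym (negPf ne_r) !mul0r.
Qed.

Variables s n : nat.

Lemma sum_two (V : nmodType) (F : 'I_s * 'I_n -> V) t t' : t != t' ->
  (forall w, w.1 != t -> w.1 != t' -> F w = 0) ->
  \sum_w F w = \sum_r F (t, r) + \sum_r F (t', r).
Proof.
move=> ne_tt' F0; rewrite (eq_bigr (fun w => F (w.1, w.2))) => [|[] //].
rewrite -(pair_bigA _ (fun a b => F (a, b))) /= (bigD1 t) //=; congr (_ + _).
rewrite (bigD1 t') /= 1?eq_sym // [X in _ + X]big1 ?addr0 // => a /andP[ne_t ne_t'].
by rewrite big1 // => b _; apply: F0.
Qed.

Definition two_sets (t t' : 'I_s) (X X' : {set 'I_n}) : {set 'I_s * 'I_n} :=
  [set w | (w.1 == t) && (w.2 \in X) || (w.1 == t') && (w.2 \in X')]%SET.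

Lemma card_two_sets t t' X X' : t != t' ->
  #|two_sets t t' X X'| = (#|X| + #|X'|)%N.
Proof.
move=> ne_tt'; rewrite -!sum1_card big_mkcond /=.
rewrite (sum_two ne_tt') => [|w /negPf nt /negPf nt']; last by rewrite inE nt nt'.
rewrite [in RHS]big_mkcond [X in _ = (_ + X)%N]big_mkcond.
congr (_ + _)%N; apply: eq_bigr => r _; rewrite inE /= eqxx /=.
  by rewrite (negPf ne_tt') orbF.
by rewrite eq_sym (negPf ne_tt').
Qed.

End Relations.

Section FlagTypes.
Variables (K : fieldType) (n : nat).
Implicit Types (H : {vspace 'rV[K]_n}) (Psi : 'M[K]_n) (A T : {set 'I_n}).

Lemma flag_jumps H Psi : Psi \in unitmx ->
  exists T N, echelon_shape T N /\
    forall v, (v \in H) = (v <= coord_mx K T *m (1%:M + N) *m Psi)%MS.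
Proof.
move=> uPsi; have [T [N [shN eqN]]] := echelon_exists (vsmx H *m invmx Psi).
exists T, N; split=> // v.
by rewrite mem_vsmx sub_mulmx_unit // eqN sub_mulmx_unit ?unitmx_inv // invmxK mulmxKV.
Qed.

Section OneFlag.
Variables (H : {vspace 'rV[K]_n}) (Psi : 'M[K]_n) (T : {set 'I_n}) (N : 'M[K]_n).
Hypotheses (uPsi : Psi \in unitmx) (shN : echelon_shape T N).
Hypothesis defH : forall v, (v \in H) = (v <= coord_mx K T *m (1%:M + N) *m Psi)%MS.

Lemma card_jumps : \dim H = #|T|.
Proof.
rewrite (dim_coord uPsi defH) mxrankMfree; last by rewrite row_free_unit (shape_unit shN).
exact/eqP/row_free_coord_mx.
Qed.

(** The intersection of [H] with a flag member has dimension at most the number of jumps below its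
    index, while the Schubert condition at [elt A i] demands at least [i]. *)
Lemma jumps_le l A i : #|A| = l -> schubert_variety l A (row_flag Psi) H ->
  (0 < i <= #|T|)%N -> (elt T i <= elt A i)%N.
Proof.
move=> cA /(schubert_lowE uPsi defH cA)[rk low] hi.
have cT : #|T| = l by rewrite -card_jumps (dim_coord uPsi defH).
have hi' : (0 < i <= #|A|)%N by rewrite cA -cT.
rewrite elt_le_cnt // -{1}(cnt_elt hi'); apply: leq_trans (low _ (elt_le hi')) _.
exact: rank_cap_shape.
Qed.

Lemma mem_flag_jumps x v : (x <= n)%N -> v \in H -> v \in row_flag Psi (inord x) ->
  exists2 d : 'rV[K]_n, (forall j, j \notin [set r in T | (r < x)%N]%SET -> d 0 j = 0) &
    v = d *m ((1%:M + N) *m Psi).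
Proof.
move=> le_xn; rewrite (mem_coord uPsi defH) mem_row_flag // => vH vx.
exists (v *m invmx Psi *m (1%:M - N)).
  by apply/sub_coord_mxP; apply: sub_shape_pid.
by rewrite mulmxA -(mulmxA _ (1%:M - N)) (shape_mul_inv shN) mulmx1 mulmxKV.
Qed.

(** The entries of [N] lie left of the diagonal, so row [i] of [(1 + N) Psi] belongs to every flag
    member of index above [i]. *)
Lemma killed_flag_rows (x : nat) (y : 'cV[K]_n) (i : 'I_n) : (x <= n)%N ->
  killed y (row_flag Psi (inord x)) -> (i < x)%N ->
  ((1%:M + N) *m Psi *m y) i 0 = 0.
Proof.
move=> le_xn ky lt_ix; have := ky (row i ((1%:M + N) *m Psi)).
rewrite -row_mul mem_row_flag // -row_mul mulmxK // => h.
have /h /(congr1 (fun M : 'M_1 => M 0 0)) : (row i (1%:M + N) <= (pid_mx x : 'M_n))%MS.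
  apply/sub_pid_mxP => r j le_xj; rewrite !mxE.
  have lt_ij : (i < j)%N := leq_trans lt_ix le_xj.
  rewrite shN ?addr0; last by rewrite !negb_and -leqNgt (ltnW lt_ij) !orbT.
  by case: eqP => // eq_ij; rewrite eq_ij ltnn in lt_ij.
by rewrite mxE [RHS]mxE.
Qed.
End OneFlag.

End FlagTypes.

(** * Parametrization of the bad flags *)

Lemma polyfun_eq (K : fieldType) (J : finType) (f g : (J -> K) -> K) :
  (forall x, f x = g x) -> polyfun g -> polyfun f.
Proof. by move=> eq_fg [p gE]; exists p => x; rewrite eq_fg. Qed.

Lemma polyfun_mulmx (K : fieldType) (J : finType) m n p
    (A : (J -> K) -> 'M[K]_(m, n)) (B : (J -> K) -> 'M[K]_(n, p)) i j :
  (forall i k, polyfun (fun x => A x i k)) -> (forall k j, polyfun (fun x => B x k j)) ->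
  polyfun (fun x => (A x *m B x) i j).
Proof.
move=> pA pB; apply: (@polyfun_eq _ _ _ (fun x => \sum_k A x i k * B x k j)).
  by move=> x; rewrite mxE.
by apply: polyfun_sum => k; apply: polyfunM.
Qed.

Definition flat (K : fieldType) (s n : nat) (Psi : 'I_s -> 'M[K]_n)
    (v : 'I_s * 'I_n * 'I_n) : K :=
  let: (t, i, j) := v in Psi t i j.

Section Parametrization.
Variables (K : fieldType) (s n : nat).

(* The matrices [(1 - N_t) P_t (1 + A)]: the subspace is spanned by the rows of
   [1 + A] with index in [D], its jumps in the [t]-th flag are [T t], and the
   entries of the row [z] of the [P_t] in the columns [C] are replaced by a
   combination of the rows in [R], whose coefficients are the last parameters. *)
Definition param_index : Type :=
  ('I_n * 'I_n + 'I_s * 'I_n * 'I_n + 'I_s * 'I_n * 'I_n + 'I_s * 'I_n)%type.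

Definition paramA (i j : 'I_n) : param_index := inl (inl (inl (i, j))).
Definition paramN (t : 'I_s) (i j : 'I_n) : param_index := inl (inl (inr (t, i, j))).
Definition paramP (t : 'I_s) (i j : 'I_n) : param_index := inl (inr (t, i, j)).
Definition paramC (w : 'I_s * 'I_n) : param_index := inr w.

Variables (T : 'I_s -> {set 'I_n}) (D C : {set 'I_n}).
Variables (R : {set 'I_s * 'I_n}) (z : 'I_s * 'I_n).

(** The positions of the [P_t] not forced to vanish: the rows at the jumps stay in the coordinate
    subspace of [D]. *)
Definition frame (w : 'I_s * 'I_n) (j : 'I_n) : bool := (w.2 \notin T w.1) || (j \in D).

Definition param_supp (v : param_index) : bool :=
  match v with
  | inl (inl (inl (i, j))) => (i \in D) && (j \notin D)
  | inl (inl (inr (t, i, j))) => [&& i \in T t, j \notin T t & (j < i)%N]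
  | inl (inr (t, i, j)) => frame (t, i) j && ~~ (((t, i) == z) && (j \in C))
  | inr w => (w \in R) && (w != z)
  end.

Definition param_P (x : param_index -> K) (t : 'I_s) : 'M[K]_n :=
  \matrix_(i, j) if ((t, i) == z) && (j \in C)
    then \sum_(w in R | w != z) x (paramC w) * x (paramP w.1 w.2 j)
    else x (paramP t i j).

Definition param_mx (x : param_index -> K) (t : 'I_s) : 'M[K]_n :=
  (1%:M - \matrix_(i, j) x (paramN t i j)) *m param_P x t
  *m (1%:M + \matrix_(i, j) x (paramA i j)).

Lemma polyfun_param t i j : polyfun (fun x => param_mx x t i j).
Proof.
apply: polyfun_mulmx => [i1 k1|k1 j1].
  apply: polyfun_mulmx => [i2 k2|k2 j2].
    apply: (@polyfun_eq _ _ _ (fun x => (i2 == k2)%:R + (-1) * x (paramN t i2 k2))).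
      by move=> x; rewrite !mxE mulN1r.
    apply: polyfunD; first exact: polyfun_const.
    by apply: polyfunM; [apply: polyfun_const|apply: polyfun_coord].
  case hole: (((t, k2) == z) && (j2 \in C)).
    apply: (@polyfun_eq _ _ _ (fun x => \sum_(w in R | w != z)
      x (paramC w) * x (paramP w.1 w.2 j2))); first by move=> x; rewrite mxE hole.
    by apply: polyfun_sum => w; apply: polyfunM; apply: polyfun_coord.
  apply: (@polyfun_eq _ _ _ (fun x => x (paramP t k2 j2))).
    by move=> x; rewrite mxE hole.
  exact: polyfun_coord.
apply: (@polyfun_eq _ _ _ (fun x => (k1 == j1)%:R + x (paramA k1 j1))).
  by move=> x; rewrite !mxE.
by apply: polyfunD; [apply: polyfun_const|apply: polyfun_coord].
Qed.

(** Dividing the relation by [c z] expresses the replaced entries of row [z] through the other rows.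
    A nonzero [c z] is demanded only along with a column of [C], so that an empty [C] with [c = 0]
    covers tuples without a relation. *)
Lemma param_cover (N P : 'I_s -> 'M[K]_n) (A : 'M[K]_n) (c : 'I_s * 'I_n -> K) :
  (forall t, echelon_shape (T t) (N t)) ->
  (forall i j, ~~ ((i \in D) && (j \notin D)) -> A i j = 0) ->
  (forall t i j, i \in T t -> j \notin D -> P t i j = 0) ->
  (forall w, w \notin R -> c w = 0) ->
  (forall j, j \in C -> c z != 0 /\ \sum_w c w * P w.1 w.2 j = 0) ->
  exists2 x : param_index -> K, forall v, ~~ param_supp v -> x v = 0 &
    forall t, (1%:M - N t) *m P t *m (1%:M + A) = param_mx x t.
Proof.
move=> shN shA shP cR relC.
pose x (v : param_index) := match v with
  | inl (inl (inl (i, j))) => A i j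
  | inl (inl (inr (t, i, j))) => N t i j
  | inl (inr (t, i, j)) => if ((t, i) == z) && (j \in C) then 0 else P t i j
  | inr w => if (w \in R) && (w != z) then - (c w / c z) else 0
  end.
exists x.
  case=> [[[[i j]|[[t i] j]]|[[t i] j]]|w] /=.
  - exact: shA.
  - exact: shN.
  - rewrite negb_and negbK; case: ifP => //= _; rewrite orbF /frame negb_or negbK.
    by case/andP; apply: shP.
  - by move/negPf => ->.
move=> t; congr (_ *m _ *m _); last by congr (_ + _); apply/matrixP => i j; rewrite mxE.
  by congr (_ - _); apply/matrixP => i j; rewrite mxE.
apply/matrixP => i j; rewrite mxE; case: ifP => [/andP[/eqP zE jC]|hole].
  have [nz_cz] := relC j jC; rewrite (bigD1 z) //= => rel.
  transitivity (\sum_(w | w != z) - (c w / c z) * P w.1 w.2 j).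
    apply: (mulfI nz_cz); rewrite mulr_sumr; move: rel.
    have -> : P t i j = P z.1 z.2 j by rewrite -zE.
    move/eqP; rewrite addr_eq0 => /eqP ->; rewrite -sumrN.
    by apply: eq_bigr => w _; rewrite mulNr mulrN mulrA mulrCA divff // mulr1.
  rewrite big_mkcond [RHS]big_mkcond; apply: eq_bigr => -[t' i'] _ /=.
  case: (boolP ((t', i') \in R)) => [_|/cR ->] /=.
    by case: eqP.
  by case: ifP => //; rewrite mul0r oppr0 mul0r.
by rewrite /= hole.
Qed.

(** The replaced entries lie inside the frame, so each of them is one parameter less, while the
    combination brings one coefficient per row of [R] other than [z]. *)
Lemma card_param_supp l : #|D| = l -> (forall t, #|T t| = l) ->
  (forall j, j \in C -> frame z j) ->
  (#|[set v | param_supp v]%SET| + #|C| =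
   l * (n - l) + \sum_t inversions (T t) + \sum_(t < s) (n * n - l * (n - l))
   + #|R :\ z|%SET)%N.
Proof.
move=> cD cT frC.
have sum1_pair (X Y : finType) (Q : X -> Y -> bool) :
    (\sum_(p : X * Y | let '(x, y) := p in Q x y) 1 = \sum_x \sum_(y | Q x y) 1)%N.
  by rewrite (pair_big_dep xpredT Q (fun _ _ => 1%N)); apply: eq_bigl => -[].
have sum1_box (X X' : {set 'I_n}) :
    (\sum_(i < n) \sum_(j | (i \in X) && (j \notin X')) 1 = #|X| * #|(~: X')%SET|)%N.
  rewrite -sum_nat_const [RHS]big_mkcond; apply: eq_bigr => i _ /=.
  case: (i \in X) => /=; last by rewrite big_pred0.
  by rewrite -sum1_card; apply: eq_bigl => j; rewrite inE.
rewrite -sum1_card (eq_bigl param_supp) => [|v]; last by rewrite inE.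
rewrite !big_sumType /=.
have -> : (\sum_(i : 'I_n * 'I_n | let '(i, j) := i in (i \in D) && (j \notin D)) 1
           = l * (n - l))%N.
  by rewrite sum1_pair sum1_box card_compl cD.
have -> : (\sum_(i : 'I_s * 'I_n * 'I_n | let '(p, j) := i in let '(t, i) := p in
              [&& i \in T t, j \notin T t & (j < i)%N]) 1
           = \sum_t inversions (T t))%N.
  rewrite (eq_bigl (fun v : 'I_s * 'I_n * 'I_n => let '(p, j) := v in
    [&& p.2 \in T p.1, j \notin T p.1 & (j < p.2)%N])) => [|[[]] //].
  rewrite sum1_pair -(pair_bigA _ (fun t i =>
    \sum_(j | [&& i \in T t, j \notin T t & (j < i)%N]) 1)%N) /=.
  apply: eq_bigr => t _; rewrite /inversions [RHS]big_mkcond; apply: eq_bigr => i _.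
  case: (i \in T t) => /=; last by rewrite big_pred0.
  by rewrite /cnt -sum1_card; apply: eq_bigl => j; rewrite !inE.
have -> : (\sum_(w | (w \in R) && (w != z)) 1 = #|R :\ z|%SET)%N.
  by rewrite -sum1_card; apply: eq_bigl => w; rewrite !inE andbC.
rewrite [LHS]addnAC; congr (_ + _)%N; rewrite -!addnA; congr (_ + (_ + _))%N.
transitivity (\sum_(v : 'I_s * 'I_n * 'I_n | let '(w, j) := v in frame w j) 1)%N.
  rewrite [RHS](bigID (fun v : 'I_s * 'I_n * 'I_n => (v.1 == z) && (v.2 \in C))) /=.
  rewrite addnC; congr (_ + _)%N; last by apply: eq_bigl => -[[]].
  rewrite (eq_bigl (fun v : 'I_s * 'I_n * 'I_n => let '(w, j) := v in
    (w == z) && (j \in C))) => [|[w j] /=]; last first.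
    by case: eqP => [-> /=|]; rewrite ?andbF //; case: (boolP (j \in C)) => [/frC ->|]; rewrite ?andbF.
  rewrite sum1_pair (bigD1 z) //= [X in (_ + X)%N]big1 => [|w ne_wz].
    by rewrite addn0 -sum1_card eqxx.
  by rewrite (negPf ne_wz) big_pred0.
rewrite sum1_pair -(pair_bigA _ (fun t i => \sum_(j | frame (t, i) j) 1)%N) /=.
apply: eq_bigr => t _; apply/eqP.
rewrite -(eqn_add2r (l * (n - l))) subnK; last first.
  by rewrite leq_mul ?leq_subr // -cD -[leqRHS]card_ord max_card.
rewrite -{1}(cT t) -{1}cD -card_compl -sum1_box -big_split /=; apply/eqP.
transitivity (\sum_(i < n) n)%N; last by rewrite sum_nat_const card_ord.
apply: eq_bigr => i _.
rewrite -[RHS]card_ord -sum1_card [RHS](bigID (frame (t, i))) /=; congr (_ + _)%N.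
by apply: eq_bigl => j; rewrite /frame /= negb_or negbK.
Qed.

End Parametrization.

(** * A nonzero polynomial vanishing on the bad tuples *)

Section BadLocus.
Variables (K : fieldType) (s n l : nat).

Section Decomposition.
Variables (H : {vspace 'rV[K]_n}) (Psi : 'I_s -> 'M[K]_n).
Variables (T : 'I_s -> {set 'I_n}) (N : 'I_s -> 'M[K]_n).
Variables (D : {set 'I_n}) (A : 'M[K]_n).
Hypothesis uPsi : forall t, Psi t \in unitmx.
Hypothesis shN : forall t, echelon_shape (T t) (N t).
Hypothesis shA : echelon_shape D A.
Hypothesis defH : forall t v,
  (v \in H) = (v <= coord_mx K (T t) *m (1%:M + N t) *m Psi t)%MS.
Hypothesis defD : forall v, (v \in H) = (v <= coord_mx K D *m (1%:M + A))%MS.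

(** The factor on the right moves [H] to the coordinate subspace of [D]; the factor on the left
    makes the rows at the jumps [T t] span it. This is the matrix [P_t] of the parametrization. *)
Definition adapted t : 'M[K]_n := (1%:M + N t) *m Psi t *m (1%:M - A).

Lemma adapted_decomp t : (1%:M - N t) *m adapted t *m (1%:M + A) = Psi t.
Proof.
rewrite /adapted !mulmxA (shape_mul_inv (@shN t)) mul1mx -mulmxA.
by rewrite (shape_mul_inv shA) mulmx1.
Qed.

Lemma adapted_mul t : adapted t *m (1%:M + A) = (1%:M + N t) *m Psi t.
Proof. by rewrite /adapted -mulmxA (shape_mul_inv shA) mulmx1. Qed.

Lemma adapted0 t i j : i \in T t -> j \notin D -> adapted t i j = 0.
Proof.
move=> iT jD; have : (coord_mx K (T t) *m adapted t <= coord_mx K D)%MS.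
  have -> : coord_mx K D = coord_mx K D *m (1%:M + A) *m (1%:M - A).
    by rewrite -mulmxA (shape_inv_mul shA) mulmx1.
  rewrite /adapted !mulmxA submxMr //.
  apply/row_subP => r; rewrite -defD (defH t).
  exact: row_sub.
move/sub_coord_mxP/(_ (enum_rank_in iT i) j jD).
by rewrite row_coord_mx enum_rankK_in.
Qed.

(** A singular square minor seen through its rows: equal sizes of [R] and [C] are what make the
    parametrization lose exactly one parameter. *)
Definition relation (R : {set 'I_s * 'I_n}) (C : {set 'I_n})
    (c : 'I_s * 'I_n -> K) (z : 'I_s * 'I_n) : Prop :=
  [/\ #|R| = #|C|, forall j, j \in C -> frame T D z j, c z != 0,
      forall w, w \notin R -> c w = 0 &
      forall j, j \in C -> \sum_w c w * adapted w.1 w.2 j = 0].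

Variables t t' : 'I_s.
Hypothesis ne_tt' : t != t'.
Hypotheses (cT : #|T t| = l) (cT' : #|T t'| = l) (cD : #|D| = l).

(** The common vector is a combination of rows at jumps in either flag, and the difference of the
    two combinations is the relation. It involves [i.+1] jumps of the first flag and, because of the
    lowered index, [l - i.+1] of the second: [l] rows against the [l] columns of [D]. *)
Lemma meet_relation :
  flag_meet l H (row_flag (Psi t)) (row_flag (Psi t')) (T t) (T t') ->
  exists R C c z, relation R C c z.
Proof.
case=> i [v [nz_v vH vt vt']].
have hi : (0 < i.+1 <= #|T t|)%N by rewrite cT ltn_ord.
have hj : (0 < l - i <= #|T t'|)%N by rewrite cT' subn_gt0 ltn_ord leq_subr.
set x := elt _ _ in vt; set x' := (elt _ _).-1 in vt'.
have le_xn : (x <= n)%N := elt_le hi.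
have le_xn' : (x' <= n)%N by apply: leq_trans (leq_pred _) (elt_le hj).
have [d dX dE] := mem_flag_jumps (uPsi t) (@shN t) (defH t) le_xn vH vt.
have [d' dX' dE'] := mem_flag_jumps (uPsi t') (@shN t') (defH t') le_xn' vH vt'.
pose R := two_sets t t' [set r in T t | (r < x)%N]%SET [set r in T t' | (r < x')%N]%SET.
pose c (w : 'I_s * 'I_n) := if w.1 == t then d 0 w.2 else if w.1 == t' then - d' 0 w.2 else 0.
have cR w : w \notin R -> c w = 0.
  rewrite inE negb_or !negb_and /c => /andP[].
  case: eqP => _ /=; first by move=> /dX.
  by case: eqP => //= _ _ /dX' ->; rewrite oppr0.
have [z nz_z] : exists z, c z != 0.
  have [r nz_r] : exists r, d 0 r != 0.
    apply/existsP; apply: contraR nz_v => /existsPn h; rewrite dE.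
    suff -> : d = 0 by rewrite mul0mx.
    by apply/rowP => r; rewrite [RHS]mxE; apply/eqP/negPn/h.
  by exists (t, r); rewrite /c eqxx.
exists R, D, c, z; split=> //.
- rewrite card_two_sets // -!/(cnt _ _) cnt_elt // cnt_elt_pred // cD.
  by have := ltn_ord i; lia.
- by move=> j jD; rewrite /frame jD orbT.
move=> j jD; rewrite (sum_two ne_tt') => [|w /negPf nt /negPf nt']; last first.
  by rewrite /c nt nt' mul0r.
have e : d *m adapted t = d' *m adapted t'.
  apply: (can_inj (mulmxK (shape_unit shA))); rewrite /= -(mulmxA d) -(mulmxA d') !adapted_mul.
  by rewrite -dE -dE'.
have := congr1 (fun M : 'rV_n => M 0 j) e; rewrite !mxE => /eqP.
rewrite -subr_eq0 => /eqP e0; rewrite -[RHS]e0 -sumrN; congr (_ + _); apply: eq_bigr => r _.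
  by rewrite /c eqxx.
by rewrite /c /= eq_sym (negPf ne_tt') eqxx mulNr.
Qed.

(** The functional kills [H], so its coordinates [Z] live on the complement of [D]; it also kills
    the rows outside the jumps in both flag members. These are [i.+1] and [n - l - i.+1] rows, so a
    square matrix has [Z] in its kernel. *)
Lemma nospan_relation :
  flag_nospan (n - l) H (row_flag (Psi t)) (row_flag (Psi t')) (T t) (T t') ->
  exists R C c z, relation R C c z.
Proof.
case=> i [y [nz_y kH kt kt']].
have hi : (0 < i.+1 <= #|(~: T t)%SET|)%N by rewrite card_compl cT ltn_ord.
have hj : (0 < n - l - i <= #|(~: T t')%SET|)%N.
  by rewrite card_compl cT' subn_gt0 ltn_ord leq_subr.
set x := elt _ _ in kt; set x' := (elt _ _).-1 in kt'.
have le_xn : (x <= n)%N := elt_le hi.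
have le_xn' : (x' <= n)%N by apply: leq_trans (leq_pred _) (elt_le hj).
pose Z : 'cV[K]_n := (1%:M + A) *m y.
have Z0 j : j \in D -> Z j 0 = 0.
  move=> jD; have := kH (row j ((1%:M + A))).
  rewrite -row_mul defD => /(_ _)/(congr1 (fun M : 'M_1 => M 0 0)).
  rewrite [LHS]mxE [RHS]mxE; apply.
  rewrite (_ : row j _ = row (enum_rank_in jD j) (coord_mx K D *m (1%:M + A))).
    exact: row_sub.
  by apply/rowP => k; rewrite [LHS]mxE [RHS]mxE row_coord_mx enum_rankK_in.
have nz_Z : exists2 j, j \in (~: D)%SET & Z j 0 != 0.
  have nzZ : Z != 0.
    apply: contraNneq nz_y => /(congr1 (mulmx (1%:M - A))).
    by rewrite mulmxA (shape_mul_inv shA) mul1mx mulmx0 => ->.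
  have [j nz_j] : exists j, Z j 0 != 0.
    apply/existsP; apply: contraR nzZ => /existsPn h; apply/eqP/colP => r.
    by rewrite [RHS]mxE; apply/eqP/negPn/h.
  by exists j => //; rewrite inE; apply: contraNN nz_j => /Z0 ->.
pose R := two_sets t t' [set r in (~: T t) | (r < x)%N]%SET
  [set r in (~: T t') | (r < x')%N]%SET.
have cRC : #|R| = #|(~: D)%SET|.
  rewrite card_two_sets // -!/(cnt _ _) cnt_elt // cnt_elt_pred // card_compl cD.
  by have := ltn_ord i; lia.
have killZ u k : (((1%:M + N u) *m Psi u *m y) k 0 = 0) ->
    \sum_(j in (~: D)%SET) adapted u k j * Z j 0 = 0.
  rewrite -adapted_mul -mulmxA -/Z mxE (bigID (mem D)) /= big1 => [|j /Z0 ->].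
    by rewrite add0r => e; rewrite -[RHS]e; apply: eq_bigl => j; rewrite inE.
  by rewrite mulr0.
have [w wR|c [[z nz_z] cR] rel] := square_kernel (F := fun w => adapted w.1 w.2) cRC nz_Z.
  apply: killZ; move: wR; rewrite inE => /orP[] /andP[/eqP ->]; rewrite !inE => /andP[_ lt_w].
    exact: (killed_flag_rows (uPsi t) (@shN t) le_xn kt).
  exact: (killed_flag_rows (uPsi t') (@shN t') le_xn' kt').
exists R, (~: D)%SET, c, z; split=> // j _.
have : z \in R by apply: contraNT nz_z => /cR ->.
by rewrite inE /frame => /orP[] /andP[/eqP ->]; rewrite !inE => /andP[->].
Qed.

End Decomposition.

Variable al : 'I_s -> {set 'I_n}.

Definition bad_flags (F : 'I_s -> flag_data K n) : Prop :=
  exists H, (forall t, schubert_variety l (al t) (F t) H) /\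
  exists t t', t != t' /\
    (flag_meet l H (F t) (F t') (al t) (al t') \/
     flag_nospan (n - l) H (F t) (F t') (al t) (al t')).

Hypothesis card_al : forall t, #|al t| = l.
Hypothesis codim_al : (\sum_t codim l (al t) = l * (n - l))%N.

(** The form in which the codimension hypothesis enters the count: for the prescribed jumps and no
    relation there are exactly as many parameters as matrix entries. *)
Lemma sum_inversions : (\sum_t inversions (al t) + l * (n - l) = s * (l * (n - l)))%N.
Proof.
rewrite -{1}codim_al -big_split /=.
transitivity (\sum_(t < s) l * (n - l))%N; last by rewrite sum_nat_const card_ord.
apply: eq_bigr => t _; rewrite codimE // subnKC //.
by rewrite -{1}(card_al t) -(card_al t) inversions_le.
Qed.

Lemma bad_flags_thin : exists2 p : matpoly K n s, p != 0 &
  forall Psi, (forall t, Psi t \in unitmx) ->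
    bad_flags (fun t => row_flag (Psi t)) -> matpoly_eval p Psi = 0.
Proof.
pose I : finType := ({ffun 'I_s -> {set 'I_n}} * {set 'I_n} * {set 'I_n} *
  {set 'I_s * 'I_n} * ('I_s * 'I_n))%type.
(* The size bound belongs to [B], so that every index gives a thin set; an index violating the bound
   gives the empty one. *)
pose B (q : I) (y : 'I_s * 'I_n * 'I_n -> K) : Prop :=
  let: (T, D, C, R, z) := q in
  (#|[set v | param_supp T D C R z v]%SET| < #|{: 'I_s * 'I_n * 'I_n}|)%N /\
  exists2 x, (forall v, ~~ param_supp T D C R z v -> x v = 0) &
    y =1 flat (param_mx C R z x).
have thinB q : thin (B q).
  case: q => [[[[T D] C] R] z].
  have [lt_S|ge_S] := boolP
      (#|[set v | param_supp T D C R z v]%SET| < #|{: 'I_s * 'I_n * 'I_n}|)%N; last first.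
    by exists 1; [exact: oner_neq0|move=> x []; rewrite (negPf ge_S)].
  apply: thin_sub (thin_image (f := fun x => flat (param_mx C R z x)) _ lt_S).
    by move=> y [_ [x x0 eq_y]]; exists x => // v; rewrite inE => /x0.
  by case=> [[t i] j]; apply: polyfun_param.
have [p nz_p p0] := thin_union thinB.
exists p => // Psi uPsi [H [inX [t [t' [ne_tt' bad_tt']]]]].
suff [q Bq] : exists q, B q (flat Psi) by apply: (p0 (flat Psi)); exists q.
have /fin_all_exists[TN shTN] (u : 'I_s) : exists TN : {set 'I_n} * 'M[K]_n,
    echelon_shape TN.1 TN.2 /\ forall v,
      (v \in H) = (v <= coord_mx K TN.1 *m (1%:M + TN.2) *m Psi u)%MS.
  have [T [N [shN defH]]] := flag_jumps H (uPsi u).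
  by exists (T, N).
pose T u := (TN u).1; pose N u := (TN u).2.
have shN u : echelon_shape (T u) (N u) by case: (shTN u).
have defH u v : (v \in H) = (v <= coord_mx K (T u) *m (1%:M + N u) *m Psi u)%MS.
  by case: (shTN u).
(* For the identity matrix this is the reduced echelon form of [H] itself. *)
have [D [A [shA defD]]] := flag_jumps H (unitmx1 K n).
have {}defD v : (v \in H) = (v <= coord_mx K D *m (1%:M + A))%MS.
  by rewrite defD mulmx1.
have dimH : \dim H = l by case: (inX t).
have cT u : #|T u| = l by rewrite -(card_jumps (uPsi u) (@shN u) (defH u)).
have cD : #|D| = l.
  rewrite -dimH (card_jumps (unitmx1 K n) shA) // => v.
  by rewrite defD mulmx1.
have shA' i j : ~~ ((i \in D) && (j \notin D)) -> A i j = 0.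
  by move=> h; apply: shA; rewrite andbA negb_and h.
have leT u : (inversions (T u) <= inversions (al u) ?= iff (T u == al u))%N.
  apply: inversions_mono => [|i]; first by rewrite cT card_al.
  exact: (jumps_le (uPsi u) (@shN u) (defH u)).
pose L := (l * (n - l))%N.
have le_L : (L <= n * n)%N.
  by rewrite leq_mul ?leq_subr // -(card_al t) -[leqRHS]card_ord max_card.
have cover (R : {set 'I_s * 'I_n}) (C : {set 'I_n}) c z : (forall w, w \notin R -> c w = 0) ->
    (forall j, j \in C -> c z != 0 /\ \sum_w c w * adapted Psi N A w.1 w.2 j = 0) ->
    (#|[set v | param_supp T D C R z v]%SET| < s * (n * n))%N ->
    exists q, B q (flat Psi).
  move=> cR relC lt_S.
  have [x x0 eq_x] := param_cover shN shA'
    (fun u i j => @adapted0 H Psi T N D A shA defH defD u i j) cR relC.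
  exists ([ffun u => T u], D, C, R, z).
  have eqT v : param_supp [ffun u => T u] D C R z v = param_supp T D C R z v.
    by case: v => [[[[i j]|[[u i] j]]|[[u i] j]]|w] //=; rewrite /frame /= ffunE.
  split.
    rewrite !card_prod !card_ord -mulnA; apply: leq_ltn_trans lt_S.
    by rewrite (eq_card (B := [set v | param_supp T D C R z v]%SET)) // => v; rewrite !inE eqT.
  exists x => [v|[[u i] j]]; first by rewrite eqT; apply: x0.
  by rewrite /flat -eq_x (adapted_decomp Psi shN shA).
(* With the prescribed jumps the relation has to save one parameter; otherwise the inversions
   already do. *)
have [|neqT] := boolP [forall u, T u == al u].
  move=> /forallP eqT.
  have [R [C [c [z [cRC frC nz_z cR rel]]]]] : exists R C c z, relation Psi T N D A R C c z.
    rewrite -(eqP (eqT t)) -(eqP (eqT t')) in bad_tt'; case: bad_tt'.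
      exact: (meet_relation uPsi shN shA defH ne_tt' (cT t) (cT t') cD).
    exact: (nospan_relation uPsi shN shA defD ne_tt' (cT t) (cT t') cD).
  have zR : z \in R by apply: contraNT nz_z => /cR ->.
  apply: (cover R C c z cR) => [j jC|]; first by split=> //; apply: rel.
  have := card_param_supp R cD cT frC; have := cardsD1 z R; rewrite zR cRC.
  have -> : (\sum_u inversions (T u) = \sum_u inversions (al u))%N.
    by apply: eq_bigr => u _; rewrite (eqP (eqT u)).
  rewrite sum_nat_const card_ord; have := sum_inversions.
  have := leq_mul (leqnn s) le_L; rewrite -/L mulnBr.
  by clearbody L; move: (#|R :\ z|%SET) (#|C|) => a b; rewrite /=; lia.
(* The slot [z] must be filled even with no relation; two different subsets of ['I_n] show that an
   index exists. *)
have [i0 _] : exists i : 'I_n, i \in 'I_n.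
  have /forallPn[u neq_u] := neqT; apply/existsP; apply: contraR neq_u => /existsPn h.
  by apply/eqP/setP => i; have := h i.
apply: (cover finset.set0 finset.set0 (fun=> 0) (t, i0)) => // [j|]; first by rewrite inE.
have frC j : j \in finset.set0 -> frame T D (t, i0) j by rewrite inE.
have := card_param_supp finset.set0 cD cT frC.
rewrite finset.set0D !cards0 !addn0 => ->.
have lt_inv : (\sum_u inversions (T u) < \sum_u inversions (al u))%N.
  by rewrite (ltn_leqif (leqif_sum (fun u (_ : true) => leT u))).
rewrite sum_nat_const card_ord; have := sum_inversions.
have := leq_mul (leqnn s) le_L; rewrite -/L mulnBr.
by clearbody L; lia.
Qed.
End BadLocus.

(** * The open set of general flags *)

Section FlagMatrices.
Variables (K : fieldType) (n : nat).
Implicit Types (Psi : 'M[K]_n) (F : flag_data K n).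

Lemma row_flag_is_flag Psi : Psi \in unitmx -> is_flag (row_flag Psi).
Proof.
move=> uPsi; split=> [j|i j le_ij].
  have le_jn : (j <= n)%N by rewrite -ltnS.
  rewrite (dim_rank (mem_row_span j Psi)) mxrankMfree ?row_free_unit //.
  by rewrite rank_pid_mx.
apply/subvP => v; rewrite !mem_row_span => /submx_trans; apply; apply: submxMr.
apply/sub_pid_mxP => r k le_jk; rewrite mxE; case: eqP => //= ->.
by rewrite ltnNge (leq_trans le_ij le_jk).
Qed.

(** Row [i] is chosen in the member of dimension [i.+1] outside the previous one; the last nonzero
    coefficient of a relation would put its row into that previous member. *)
Lemma row_flag_exists F : is_flag F ->
  exists2 Psi, Psi \in unitmx & row_flag Psi = F.
Proof.
case=> dimF monoF.
have /fin_all_exists[f fP] (i : 'I_n) : exists v,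
    v \in F (lift ord0 i) /\ v \notin F (widen_ord (leqnSn n) i).
  have : ~~ (F (lift ord0 i) <= F (widen_ord (leqnSn n) i))%VS.
    by apply/negP => /dimvS; rewrite !dimF /= /bump /= add1n ltnn.
  by case/subvPn => v; exists v.
pose Psi : 'M[K]_n := \matrix_i f i.
have rowF (i : 'I_n) (j : 'I_n.+1) : (i < j)%N -> f i \in F j.
  by move=> lt_ij; have [fi _] := fP i; apply: (subvP (monoF _ _ _) _ fi); rewrite /= /bump.
have uPsi : Psi \in unitmx.
  rewrite -row_free_unit -kermx_eq0; apply/rowV0P => u /sub_kermxP uM0.
  apply/eqP; apply: contraT => nz_u.
  have [r0 nz_r0] : exists r, u 0 r != 0.
    apply/existsP; apply: contraR nz_u => /existsPn h; apply/eqP/rowP => r.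
    by rewrite [RHS]mxE; apply/eqP/negPn/h.
  have [r nz_r max_r] := @arg_maxnP _ r0 (fun r => u 0 r != 0) val nz_r0.
  have [_ /negP[]] := fP r.
  have : \sum_i u 0 i *: f i = 0.
    by rewrite -[RHS]uM0 mulmx_sum_row; apply: eq_bigr => i _; rewrite rowK.
  rewrite (bigD1 r) //= => /eqP; rewrite addr_eq0 => /eqP e.
  rewrite -[f r]scale1r -(mulVf nz_r) -scalerA e memvZ // memvN.
  apply: memv_suml => i ne_ir; have [->|nz_i] := eqVneq (u 0 i) 0.
    by rewrite scale0r mem0v.
  rewrite memvZ //; apply: rowF; rewrite /= ltn_neqAle ne_ir; exact: max_r.
exists Psi => //; apply: boolp.funext => j; apply/eqP.
have [dimP _] := row_flag_is_flag uPsi.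
rewrite eqEdim dimP dimF leqnn andbT; apply/subv_sumP => r lt_rj.
by rewrite rowK -memvE rowF.
Qed.

(* Two matrices with the same row flag differ by a lower triangular factor,
   which preserves all row flags. *)
Lemma row_flag_mul_eq Psi0 Psi Psi' :
  Psi0 \in unitmx -> Psi \in unitmx -> Psi' \in unitmx ->
  row_flag Psi0 = row_flag Psi -> row_flag (Psi0 *m invmx Psi *m Psi') = row_flag Psi'.
Proof.
move=> u0 u u' eqF; set L := _ *m invmx _.
have L0 (i j : 'I_n) : (i < j)%N -> L i j = 0.
  move=> lt_ij; have : row i Psi0 \in row_flag Psi (inord i.+1).
    rewrite -eqF mem_row_flag // -row_mul mulmxV //.
    apply/sub_pid_mxP => r k lt_ik; rewrite !mxE; case: eqP => // eq_ik.
    by rewrite eq_ik ltnn in lt_ik.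
  rewrite mem_row_flag // -row_mul => /sub_pid_mxP/(_ 0 j lt_ij).
  by rewrite mxE.
have uL : L *m Psi' \in unitmx by rewrite !unitmx_mul unitmx_inv u0 u u'.
have [dimL _] := row_flag_is_flag uL; have [dim' _] := row_flag_is_flag u'.
apply: boolp.funext => j; apply/eqP; rewrite eqEdim dimL dim' leqnn andbT.
apply/subvP => v; rewrite !mem_row_span mulmxA => /submx_trans; apply; apply: submxMr.
apply/sub_pid_mxP => r k le_jk; rewrite mxE big1 // => i _; rewrite mxE.
case: eqP => [eq_ri|]; last by rewrite mul0r.
case: ltnP => [lt_rj|]; last by rewrite mul0r.
by rewrite L0 ?mulr0 // -eq_ri (leq_trans lt_rj).
Qed.

End FlagMatrices.

Section GenericFlags.
Variables (K : numFieldType) (s n : nat) (bad : ('I_s -> 'M[K]_n) -> Prop).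

Definition unflat (x : 'I_s * 'I_n * 'I_n -> K) (t : 'I_s) : 'M[K]_n :=
  \matrix_(i, j) x (t, i, j).

Lemma flatK Psi : unflat (flat Psi) = Psi.
Proof. by apply: boolp.funext => t; apply/matrixP => i j; rewrite mxE. Qed.

Lemma unflatK x : flat (unflat x) =1 x.
Proof. by case=> [[t i] j]; rewrite /= mxE. Qed.

Lemma matpoly_evalE (p : matpoly K n s) Psi : matpoly_eval p Psi = peval p (flat Psi).
Proof. by []. Qed.

Lemma polyfun_det : polyfun (fun x : 'I_s * 'I_n * 'I_n -> K => \prod_t \det (unflat x t)).
Proof.
apply: polyfun_prod => t; apply: polyfun_sum => sg.
apply: polyfunM; first exact: polyfun_const.
apply: polyfun_prod => i; apply: (@polyfun_eq _ _ _ (fun x => x (t, i, sg i))).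
  by move=> x; rewrite mxE.
exact: polyfun_coord.
Qed.

Definition vanishing (p : matpoly K n s) : Prop :=
  forall Psi, (forall t, Psi t \in unitmx) -> bad Psi -> matpoly_eval p Psi = 0.

(** The complement of the Zariski closure of the bad tuples. All vanishing polynomials are allowed
    because a single one need not give a condition independent of the representing matrices. *)
Definition generic_flags (F : 'I_s -> flag_data K n) : Prop :=
  exists Psi, [/\ forall t, Psi t \in unitmx, F = fun t => row_flag (Psi t) &
    exists2 p, vanishing p & matpoly_eval p Psi != 0].

Hypothesis bad_flag : forall Psi Psi', (forall t, row_flag (Psi t) = row_flag (Psi' t)) ->
  bad Psi -> bad Psi'.

(** If [Psi0] and [Psi] represent the same flags, composing [p0] with left multiplication by
    [L = Psi0 Psi^-1] gives another vanishing polynomial, as [L] preserves row flags; its value at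
    [Psi] is that of [p0] at [Psi0]. *)
Lemma generic_flags_open : zariski_open generic_flags.
Proof.
split=> [F [Psi [uPsi -> _]] t|]; first exact: row_flag_is_flag.
exists vanishing => Psi uPsi; split=> [[Psi0 [u0 eqF [p0 van0 nz0]]]|[p van nz]]; last first.
  by exists Psi; split=> //; exists p.
have eqFt t : row_flag (Psi0 t) = row_flag (Psi t).
  by have := congr1 (fun F => F t) eqF.
pose L t := Psi0 t *m invmx (Psi t).
have [|p pE] := @polyfun_comp K _ _
    (fun x => flat (fun t => L t *m unflat x t)) p0.
  case=> [[t i] j]; apply: (@polyfun_mulmx _ _ _ _ _ (fun=> L t)) => [i' k|k j'].
    exact: polyfun_const.
  apply: (@polyfun_eq _ _ _ (fun x => x (t, k, j'))); last exact: polyfun_coord.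
  by move=> x; rewrite mxE.
have evalp Psi' : matpoly_eval p Psi' = matpoly_eval p0 (fun t => L t *m Psi' t).
  by rewrite !matpoly_evalE -pE flatK.
exists p.
  move=> Psi' u' bad'; rewrite evalp; apply: van0 => [t|].
    by rewrite !unitmx_mul unitmx_inv u0 uPsi u'.
  by apply: bad_flag bad' => t; rewrite row_flag_mul_eq.
rewrite evalp (_ : (fun t => _) = Psi0) //; apply: boolp.funext => t.
by rewrite /L mulmxKV.
Qed.

(** The product of [p], a polynomial that is nonzero somewhere on [W], and all determinants is a
    nonzero polynomial; over an infinite field it has a nonroot, which represents flags in both
    sets. *)
Lemma generic_flags_dense p : vanishing p -> p != 0 -> zariski_dense generic_flags.
Proof.
move=> van nz_p W [flagW [P PW]] [F0 WF0].
have /fin_all_exists[Psi0 h0] (t : 'I_s) : exists Psi, Psi \in unitmx /\ row_flag Psi = F0 t.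
  by have [Psi] := row_flag_exists (flagW _ WF0 t); exists Psi.
have u0 t : Psi0 t \in unitmx by case: (h0 t).
have F0E : F0 = fun t => row_flag (Psi0 t).
  by apply: boolp.funext => t; case: (h0 t) => _ ->.
have [q Pq nz_q] : exists2 q, P q & matpoly_eval q Psi0 != 0.
  by apply/(PW _ u0); rewrite -F0E.
have nzq : q != 0.
  by apply: contraNneq nz_q => ->; rewrite /matpoly_eval meval0.
have [d dE] := polyfun_det.
have nzd : d != 0.
  have := dE (flat (fun=> 1%:M)); rewrite flatK big1 => [|t _]; last exact: det1.
  by move=> e; apply: contraTneq isT => d0; move/eqP: e; rewrite d0 /peval meval0 oner_eq0.
have [x nz_x] := mpoly_nonroot (mulf_neq0 (mulf_neq0 nz_p nzq) nzd).
pose Psi := unflat (fun v => x (enum_rank v)).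
have evalE r : matpoly_eval r Psi = r.@[x].
  rewrite matpoly_evalE; apply: meval_eq => v.
  by rewrite (unflatK (fun v => x (enum_rank v))) enum_valK.
move: nz_x; rewrite !mevalM !mulf_eq0 !negb_or -!evalE => /andP[/andP[nzp' nzq'] nzd'].
have uPsi t : Psi t \in unitmx.
  move: nzd'; rewrite matpoly_evalE -dE flatK => /prodf_neq0/(_ t isT).
  by rewrite unitmxE unitfE.
exists (fun t => row_flag (Psi t)); split.
  by exists Psi; split=> //; exists p.
by apply/(PW _ uPsi); exists q.
Qed.

Lemma generic_flagsN F : generic_flags F ->
  exists2 Psi, F = (fun t => row_flag (Psi t)) & ~ bad Psi.
Proof.
case=> Psi [uPsi -> [p van nz]]; exists Psi => // badPsi.
by case/eqP: nz; apply: van.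
Qed.

End GenericFlags.

(** * The system of equations *)

Section RowSpace.
Variables (K : fieldType) (n p q : nat).
Implicit Types (G : 'M[K]_(p, n)) (X : {set 'I_n}).

Lemma eqmx_schubert_low G (G' : 'M[K]_(q, n)) X :
  (G' :=: G)%MS -> schubert_low X G' -> schubert_low X G.
Proof. by move=> eqG h x /h; rewrite (cap_eqmx eqG (eqmx_refl _)). Qed.

Lemma eqmx_schubert_high G (G' : 'M[K]_(q, n)) X :
  (G' :=: G)%MS -> schubert_high X G' -> schubert_high X G.
Proof. by move=> eqG h x /h; rewrite (cap_eqmx eqG (eqmx_refl _)). Qed.

Lemma mul0_sub_ann G (N : 'M[K]_(n, q)) : G *m N = 0 <-> (N^T <= kermx G^T)%MS.
Proof.
split=> [GN0|/sub_kermxP/(congr1 trmx)]; last by rewrite trmx_mul !trmxK trmx0.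
by apply/sub_kermxP; rewrite -trmx_mul GN0 trmx0.
Qed.

End RowSpace.

Section ColumnForm.
Variables (K : fieldType) (n l p : nat) (A B : {set 'I_n}) (G : 'M[K]_(p, n)).
Hypotheses (cA : #|A| = l) (cB : #|B| = l) (cAB : compatible l A B).
Hypothesis rkG : \rank G = l.

Let cA' : #|perp A| = (n - l)%N. Proof. by rewrite card_perp cA. Qed.
Let cB' : #|perp B| = (n - l)%N. Proof. by rewrite card_perp cB. Qed.
Let cAB' : compatible (n - l) (perp B) (perp A). Proof. exact: compatible_perp. Qed.

(** [N^T] has rank [n - l], so it spans the annihilator of [G], whose Schubert conditions are dual
    to those of [G]. *)
Lemma calN_schubert (N : 'M[K]_(n, n - l)) : calN A B N -> G *m N = 0 ->
  schubert_low A G /\ schubert_high B G.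
Proof.
move=> hN /mul0_sub_ann sN; have freeN := calM_row_free cB' cA' cAB' hN.
have eqN : (N^T :=: kermx G^T)%MS.
  apply/eqmxP; rewrite -(geq_leqif (mxrank_leqif_eq sN)) mxrank_ker mxrank_tr rkG.
  by rewrite (eqP freeN).
split.
  apply/(schubert_low_ann rkG cA)/(eqmx_schubert_high eqN).
  exact: calM_schubert_high cB' cA' cAB' _ hN.
apply/(schubert_high_ann rkG cB)/(eqmx_schubert_low eqN).
exact: calM_schubert_low cB' cA' cAB' _ hN.
Qed.

Lemma calN_exists : schubert_low A G -> schubert_high B G ->
  generic (n - l) (perp B) (perp A) (kermx G^T) ->
  exists2 N : 'M[K]_(n, n - l), calN A B N & G *m N = 0.
Proof.
move=> lowG highG gG.
have [||||M hM eqM] := calM_exists cB' cA' cAB' (G := kermx G^T).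
- by rewrite mxrank_ker mxrank_tr rkG.
- exact: (schubert_high_ann rkG cB).2.
- exact: (schubert_low_ann rkG cA).2.
- exact: gG.
exists M^T; first by rewrite /calN trmxK.
by apply/mul0_sub_ann; rewrite trmxK eqM.
Qed.

Lemma calN_unique (N N' : 'M[K]_(n, n - l)) :
  generic (n - l) (perp B) (perp A) (kermx G^T) -> calN A B N -> calN A B N' ->
  G *m N = 0 -> G *m N' = 0 -> N = N'.
Proof.
move=> gG hN hN' /mul0_sub_ann sN /mul0_sub_ann sN'; apply: trmx_inj.
exact: calM_unique gG hN hN' sN sN'.
Qed.

End ColumnForm.

(** * Free entries as coordinates, and the equations as polynomials in them *)

Section Entries.
Variables (K : fieldType) (n : nat).

(** Compatibility keeps the leading one within the bound [elt A i.+1], so the prescribed zeros and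
    the prescribed one never clash. *)
Lemma calMP m (A B : {set 'I_n}) (M : 'M[K]_(m, n)) : #|A| = m -> #|B| = m ->
  compatible m A B ->
  calM A B M <-> forall i j, ~~ calM_free A B i j ->
                   M i j = (j.+1 == n.+1 - elt B (m - i))%N%:R.
Proof.
move=> cA cB cAB; split=> [hM i j|hM i j].
  have [h1 h2 h3] := hM i j.
  rewrite /calM_free negb_and -leqNgt -ltnNge.
  have [/andP[b1 b2] b3] := compatible_bounds i cA cB cAB.
  case: eqP => [/h3 //|ne_j] /orP[le_j|/h2 //].
  by apply: h1; rewrite ltn_neqAle le_j andbT; apply/eqP.
have [/andP[b1 b2] b3] := compatible_bounds i cA cB cAB.
split=> h; rewrite hM /calM_free ?negb_and -?leqNgt -?ltnNge.
- by rewrite ltn_eqF.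
- by rewrite ltnW.
- by rewrite gtn_eqF // (leq_ltn_trans b2).
- by apply/orP; right.
- by rewrite h eqxx.
- by rewrite h leqnn.
Qed.

Variables (l k : nat) (hk : (0 < k)%N) (al : 'I_k.*2 -> {set 'I_n}).

Definition entry_const (v : entry_pos n l k) : K :=
  match v with
  | inl (r, c) => (c.+1 == n.+1 - elt (al (idx_even (last_pair hk))) (l - r))%N%:R
  | inr (i, r, c) =>
      (r.+1 == n.+1 - elt (perp (al (idx_odd (early_pair i)))) (n - l - c))%N%:R
  end.

Hypothesis card_al : forall t, #|al t| = l.
Hypothesis compat : forall i, compatible l (al (idx_odd i)) (al (idx_even i)).

Lemma coord_spaceP (X : unknowns K n l k) :
  coord_space hk al X <->
  forall v, ~~ is_var hk al v -> entry X v = entry_const v.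
Proof.
split=> [[hM hN] [[r c]|[[i r] c]] /= nfree|h].
- exact: (calMP _ (card_al _) (card_al _) (compat _)).1 hM _ _ nfree.
- have := (calMP _ _ _ (compatible_perp (card_al _) (card_al _) (compat _))).1 (hN i) c r nfree.
  by rewrite !card_perp !card_al mxE; apply.
split; first by apply/calMP => // r c; apply: (h (inl (r, c))).
move=> i; apply/calMP; rewrite ?card_perp ?card_al //.
  exact: compatible_perp.
by move=> c r nfree; rewrite mxE; apply: (h (inr (i, r, c))).
Qed.

Lemma entry_inj (X X' : unknowns K n l k) : entry X =1 entry X' -> X = X'.
Proof.
case: X X' => [M N] [M' N'] eqX; congr (_, _).
  by apply/matrixP => r c; apply: (eqX (inl (r, c))).
by apply/ffunP => i; apply/matrixP => r c; apply: (eqX (inr (i, r, c))).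
Qed.

Lemma entry_surj (e : entry_pos n l k -> K) : exists X, entry X =1 e.
Proof.
exists (\matrix_(r, c) e (inl (r, c)), [ffun i => \matrix_(r, c) e (inr (i, r, c))]).
by case=> [[r c]|[[i r] c]] /=; rewrite ?ffunE mxE.
Qed.

Lemma var_pos_is_var (t : 'I_(nvars l hk al)) : is_var hk al (var_pos t).
Proof. by have := enum_valP t. Qed.

Lemma var_pos_surj v : is_var hk al v -> exists t : 'I_(nvars l hk al), var_pos t = v.
Proof. by move=> hv; exists (enum_rank_in hv v); rewrite /var_pos enum_rankK_in. Qed.

Lemma coords_bij : set_bij (@coord_space K n l k hk al) [set: _]%classic (coords hk al).
Proof.
split=> // [X X' /set_mem/coord_spaceP hX /set_mem/coord_spaceP hX' eqX|c _].
  apply: entry_inj => v; have [/var_pos_surj[t <-]|nv] := boolP (is_var hk al v).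
    by have := congr1 (fun c => c t) eqX.
  by rewrite hX // hX'.
have [X hX] := entry_surj (fun v =>
  if [pick t : 'I_(nvars l hk al) | var_pos t == v] is Some t then c t else entry_const v).
exists X.
  apply/coord_spaceP => v nv; rewrite hX; case: pickP => // t /eqP tv.
  by rewrite -tv var_pos_is_var in nv.
apply: boolp.funext => t; rewrite /coords hX; case: pickP => [u /eqP/enum_val_inj -> //|].
by move/(_ t); rewrite eqxx.
Qed.

Definition entry_poly (v : entry_pos n l k) : {mpoly K[nvars l hk al]} :=
  if [pick t : 'I_(nvars l hk al) | var_pos t == v] is Some t then 'X_t
  else (entry_const v)%:MP.

Lemma entry_polyE X v : coord_space hk al X ->
  (entry_poly v).@[coords hk al X] = entry X v.
Proof.
move=> /coord_spaceP hX; rewrite /entry_poly; case: pickP => [t /eqP <-|no].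
  by rewrite mevalXU.
rewrite mevalC hX //; apply/negP => /var_pos_surj[t tv].
by have := no t; rewrite tv eqxx.
Qed.

Lemma entry_poly_supp v m : m \in msupp (entry_poly v) ->
  (\sum_t m t <= 1)%N /\ forall t, var_pos t != v -> m t = 0%N.
Proof.
rewrite /entry_poly; case: pickP => [u /eqP uv|_].
  rewrite msuppX inE => /eqP ->; split; first by rewrite -mdegE mdeg1.
  move=> t ne_t; rewrite mnm1E; case: eqP => // eq_ut.
  by rewrite -eq_ut uv eqxx in ne_t.
rewrite msuppC; case: ifP => // _; rewrite inE => /eqP ->; split.
  by rewrite big1 // => t _; rewrite mnm0E.
by move=> t _; rewrite mnm0E.
Qed.

Lemma bilinear_entries (i : 'I_k.-1) (W : 'M[K]_n) a b :
  bilinear_in i (\sum_c \sum_d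
    W c d *: (entry_poly (inl (a, c)) * entry_poly (inr (i, d, b)))).
Proof.
move=> m /msupp_sum_le /flatten_mapP[c _] /msupp_sum_le /flatten_mapP[d _].
move=> /msuppZ_le /msuppM_le /allpairsP[[m1 m2] /=].
case=> /entry_poly_supp[s1 z1] /entry_poly_supp[s2 z2] ->.
have sum_le (P : pred 'I_(nvars l hk al)) (r : 'X_{1..nvars l hk al}) :
    (\sum_(t | P t) r t <= \sum_t r t)%N.
  by rewrite [leqRHS](bigID P) leq_addr.
have M2 t : in_M (var_pos t) -> m2 t = 0%N.
  by move=> hM; apply: z2; apply: contraTneq hM => ->.
have N1 t : in_N i (var_pos t) -> m1 t = 0%N.
  by move=> hN; apply: z1; apply: contraTneq hN => ->.
split.
- rewrite (eq_bigr m1) => [|t /M2 m20]; last by rewrite mnmDE m20 addn0.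
  exact: leq_trans (sum_le _ _) s1.
- rewrite (eq_bigr m2) => [|t /N1 m10]; last by rewrite mnmDE m10.
  exact: leq_trans (sum_le _ _) s2.
move=> t nM nN; rewrite mnmDE z1 ?z2 //.
  by apply: contraNneq nN => ->; rewrite /= eqxx.
by apply: contraNneq nM => ->.
Qed.

End Entries.

Section PairIndices.
Variable k : nat.

Lemma idx_cases (t : 'I_k.*2) : exists i : 'I_k, t = idx_odd i \/ t = idx_even i.
Proof.
have lt_t : (t./2 < k)%N by have := ltn_ord t; lia.
exists (Ordinal lt_t); have := odd_double_half t.
by case: (odd t) => /= e; [right|left]; apply: val_inj => /=; lia.
Qed.

Lemma pair_cases (hk : (0 < k)%N) (i : 'I_k) :
  i = last_pair hk \/ exists j : 'I_k.-1, i = early_pair j.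
Proof.
have [lt_i|ge_i] := ltnP i k.-1; last first.
  by left; apply: val_inj => /=; have := ltn_ord i; lia.
by right; exists (Ordinal lt_i); apply: val_inj.
Qed.

Lemma idx_neq (i : 'I_k) : idx_odd i != idx_even i.
Proof. by apply/eqP => /(congr1 val) /=; lia. Qed.

End PairIndices.

(** * Common zeroes and points of the intersection *)

Section Instance.
Variables (K : fieldType) (n l k : nat) (hk : (0 < k)%N) (al : 'I_k.*2 -> {set 'I_n}).
Variables (F : 'I_k.*2 -> flag_data K n) (Phi : 'I_k -> 'M[K]_n).
Hypothesis card_al : forall t, #|al t| = l.
Hypothesis compat : forall i, compatible l (al (idx_odd i)) (al (idx_even i)).
Hypothesis goodF : ~ bad_flags l al F.
Hypothesis uPhi : forall i, Phi i \in unitmx.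
Hypothesis Fodd : forall i, F (idx_odd i) = row_flag (Phi i).
Hypothesis Feven : forall i, F (idx_even i) = row_flag (w0 K n *m Phi i).

Let Phik := Phi (last_pair hk).
Let A i := al (idx_odd i).
Let B i := al (idx_even i).
(** The subspace parametrized by [M], written in the coordinates of the [i]-th pair of flags; the
    equations say that [N_i] annihilates it. *)
Let G (M : 'M[K]_(l, n)) i := M *m Phik *m invmx (Phi i).

Definition intersection : set {vspace 'rV[K]_n} :=
  (\bigcap_(t in [set: 'I_k.*2]) schubert_variety l (al t) (F t))%classic.

Lemma G_last M : G M (last_pair hk) = M.
Proof. by rewrite /G mulmxK ?uPhi. Qed.

Lemma row_span_coord M i v : (v \in row_span l (M *m Phik)) = (v <= G M i *m Phi i)%MS.
Proof. by rewrite mem_row_span_full /G mulmxKV ?uPhi. Qed.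

Lemma good_generic H i p (G' : 'M[K]_(p, n)) : intersection H ->
  (forall v, (v \in H) = (v <= G' *m Phi i)%MS) ->
  generic l (A i) (B i) G' /\
  generic (n - l) (perp (B i)) (perp (A i)) (kermx G'^T).
Proof.
move=> inH defH; split.
  apply: (generic_meet (uPhi i) defH (card_al _) (card_al _)) => m; apply: goodF; exists H.
  split=> [t|]; first exact: inH.
  by exists (idx_odd i), (idx_even i); split; [apply: idx_neq|left; rewrite Fodd Feven].
apply: (generic_nospan (uPhi i) defH (card_al _) (card_al _)) => m; apply: goodF; exists H.
split=> [t|]; first exact: inH.
by exists (idx_odd i), (idx_even i); split; [apply: idx_neq|right; rewrite Fodd Feven].
Qed.

Lemma intersection_coord H i p (G' : 'M[K]_(p, n)) : intersection H ->
  (forall v, (v \in H) = (v <= G' *m Phi i)%MS) ->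
  [/\ \rank G' = l, schubert_low (A i) G' & schubert_high (B i) G'].
Proof.
move=> inH defH; have := inH (idx_odd i) I; have := inH (idx_even i) I.
rewrite Fodd Feven => /(schubert_highE (uPhi i) defH (card_al _))[_ highG].
by move=> /(schubert_lowE (uPhi i) defH (card_al _))[].
Qed.

(** The conditions of the last pair are read off the shape of [M], those of any other pair off the
    shape of [N_i], whose columns span the annihilator of the same subspace. *)
Lemma zeros_sub (X : unknowns K n l k) : common_zeros hk al Phi X ->
  intersection (row_span l (X.1 *m Phik)).
Proof.
case=> -[hM hN] sys t _.
have freeM := calM_row_free (card_al _) (card_al _) (compat _) hM.
have rkG i : \rank (G X.1 i) = l.
  by rewrite /G !rank_mul_unit ?unitmx_inv ?uPhi //; apply/eqP/freeM.
have lowhigh i : schubert_low (A i) (G X.1 i) /\ schubert_high (B i) (G X.1 i).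
  have [->|[j ->]] := pair_cases hk i.
    rewrite G_last; split.
      exact: calM_schubert_low (card_al _) (card_al _) (compat _) _ hM.
    exact: calM_schubert_high (card_al _) (card_al _) (compat _) _ hM.
  exact: calN_schubert (card_al _) (card_al _) (compat _) (rkG _) _ (hN j) (sys j).
have [i [->|->]] := idx_cases t; have [low high] := lowhigh i.
  rewrite Fodd; apply/(schubert_lowE (uPhi i) (row_span_coord X.1 i) (card_al _)).
  by split; [apply: rkG|].
rewrite Feven; apply/(schubert_highE (uPhi i) (row_span_coord X.1 i) (card_al _)).
by split; [apply: rkG|].
Qed.

Lemma zeros_inj (X X' : unknowns K n l k) :
  common_zeros hk al Phi X -> common_zeros hk al Phi X' ->
  row_span l (X.1 *m Phik) = row_span l (X'.1 *m Phik) -> X = X'.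
Proof.
move=> zX zX' eqH; have inH := zeros_sub zX.
case: X X' zX zX' eqH inH => [M N] [M' N'] [[hM hN] sys] [[hM' hN'] sys'] /= eqH inH.
rewrite /= in hM hN hM' hN'.
have sM' : (M' <= M)%MS.
  rewrite -(mulmxK (uPhi (last_pair hk)) M') -(mulmxK (uPhi (last_pair hk)) M).
  apply: submxMr; apply/row_subP => r.
  by rewrite -mem_row_span_full eqH mem_row_span_full row_sub.
have eqM : M = M'.
  have defH v : (v \in row_span l (M *m Phik)) = (v <= M *m Phi (last_pair hk))%MS.
    exact: mem_row_span_full.
  have [gM _] := good_generic inH defH.
  exact: calM_unique gM hM hM' (submx_refl _) sM'.
rewrite -{}eqM in sys' *; congr (_, _); apply/ffunP => i.
have [_ gN] := good_generic inH (row_span_coord M (early_pair i)).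
exact: calN_unique gN (hN i) (hN' i) (sys i) (sys' i).
Qed.

Lemma zeros_surj H : intersection H ->
  exists2 X : unknowns K n l k, common_zeros hk al Phi X & row_span l (X.1 *m Phik) = H.
Proof.
move=> inH; pose Gk := vsmx H *m invmx Phik.
have defGk v : (v \in H) = (v <= Gk *m Phi (last_pair hk))%MS.
  by rewrite /Gk mulmxKV ?uPhi // mem_vsmx.
have [rk low high] := intersection_coord inH defGk.
have [gM _] := good_generic inH defGk.
have [M hM eqM] := calM_exists (card_al _) (card_al _) (compat _) rk low high gM.
have spanM : row_span l (M *m Phik) = H.
  by apply/vspaceP => v; rewrite mem_row_span_full defGk (eqmxMr Phik eqM).
have defH i v : (v \in H) = (v <= G M i *m Phi i)%MS.
  by rewrite -row_span_coord spanM.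
have /fin_all_exists[N hN] (i : 'I_k.-1) : exists N : 'M[K]_(n, n - l),
    calN (A (early_pair i)) (B (early_pair i)) N /\ G M (early_pair i) *m N = 0.
  have [rki lowi highi] := intersection_coord inH (defH (early_pair i)).
  have [_ gN] := good_generic inH (defH (early_pair i)).
  have [N] := calN_exists (card_al _) (card_al _) (compat _) rki lowi highi gN.
  by exists N.
exists (M, [ffun i => N i]) => //; split; first split=> // i.
  by rewrite /= ffunE; case: (hN i).
by move=> i; rewrite /system_mx /= ffunE; case: (hN i).
Qed.

End Instance.

Theorem theorem3p1 (R : realType) (n l k : nat)
    (hl : (1 <= l <= n.-1)%N) (hk : (0 < k)%N)
    (al : 'I_k.*2 -> {set 'I_n})
    (hal : schubert_problem l al)
    (hcompat : forall i : 'I_k,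
       compatible l (al (idx_odd i)) (al (idx_even i))) :
  exists U : set ('I_k.*2 -> flag_data R[i] n),
    [/\ zariski_open U, zariski_dense U &
    forall F : 'I_k.*2 -> flag_data R[i] n, U F ->
    forall Phi : 'I_k -> 'M[R[i]]_n,
      (forall i : 'I_k,
         [/\ Phi i \in unitmx,
             F (idx_odd i) = row_flag (Phi i) &
             F (idx_even i) = row_flag (w0 R[i] n *m Phi i)]) ->
    [/\
      (* the common zeroes are the points of the intersection *)
      set_bij (common_zeros hk al Phi)
        (\bigcap_(t in [set: 'I_k.*2]) schubert_variety l (al t) (F t))%classic
        (fun X : unknowns R[i] n l k =>
           row_span l (X.1 *m Phi (last_pair hk))),
      (* the free entries are coordinates on the affine space of unknowns *)
      set_bij (coord_space hk al)
        [set: 'I_(nvars l hk al) -> R[i]]%classic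
        (coords hk al),
      (* the equations are bilinear polynomials in these coordinates *)
      exists p : 'I_k.-1 * 'I_l * 'I_(n - l) ->
                 {mpoly R[i][nvars l hk al]},
        (forall i a b, bilinear_in i (p (i, a, b))) /\
        (forall X : unknowns R[i] n l k, coord_space hk al X ->
           forall i a b,
           system_mx hk Phi X i a b = (p (i, a, b)).@[coords hk al X]) &
      (* there are as many equations as variables *)
      [/\ (nvars l hk al =
            \sum_(i < k)
              (l * (n - l) - codim l (al (idx_odd i))
                           - codim l (al (idx_even i))))%N,
          (\sum_(i < k)
              (l * (n - l) - codim l (al (idx_odd i))
                           - codim l (al (idx_even i))) =
            k.-1 * (l * (n - l)))%N &
          #|{: 'I_k.-1 * 'I_l * 'I_(n - l)}| = (k.-1 * (l * (n - l)))%N]]].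
Proof.
have [card_al codim_al] := hal.
(* Badness of a tuple of matrices depends on its flags alone, as openness in the quotient
   requires. *)
pose bad (Psi : 'I_k.*2 -> 'M[R[i]]_n) := bad_flags l al (fun t => row_flag (Psi t)).
have bad_flag Psi Psi' : (forall t, row_flag (Psi t) = row_flag (Psi' t)) ->
    bad Psi -> bad Psi'.
  by rewrite /bad => /boolp.funext ->.
have [p nz_p van_p] := bad_flags_thin R[i] card_al codim_al.
exists (generic_flags bad); split.
- exact: generic_flags_open.
- exact: generic_flags_dense van_p nz_p.
move=> F genF Phi hPhi.
have goodF : ~ bad_flags l al F by have [Psi -> nbad] := generic_flagsN genF.
have uPhi i : Phi i \in unitmx by have [] := hPhi i.
have Fodd i : F (idx_odd i) = row_flag (Phi i) by have [] := hPhi i.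
have Feven i : F (idx_even i) = row_flag (w0 R[i] n *m Phi i) by have [] := hPhi i.
split.
- split=> [X zX|X X' /set_mem zX /set_mem zX'|H inH].
  + exact: (zeros_sub card_al hcompat uPhi Fodd Feven zX).
  + exact: (zeros_inj card_al hcompat goodF uPhi Fodd Feven zX zX').
  + exact: (zeros_surj hk card_al hcompat goodF uPhi Fodd Feven inH).
- exact: coords_bij.
(* The entry of [M W N_i] with the constant matrix [W = Phi_k Phi_i^-1], each entry of [M] and [N_i]
   being a variable or a constant. *)
- exists (fun q => let: (i, a, b) := q in \sum_c \sum_d
    (Phi (last_pair hk) *m invmx (Phi (early_pair i))) c d *:
    (entry_poly R[i] hk al (inl (a, c)) * entry_poly R[i] hk al (inr (i, d, b)))).
  split=> [i a b|X hX i a b]; first exact: bilinear_entries.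
  rewrite /system_mx -mulmxA -!(mulmxA X.1) mxE raddf_sum /=.
  apply: eq_bigr => c _; rewrite mulmxA mxE mulr_sumr raddf_sum /=.
  apply: eq_bigr => d _; rewrite mevalZ mevalM !entry_polyE //=.
  by rewrite mulrCA.
split; first exact: nvarsE.
  exact: sum_codims.
by rewrite !card_prod !card_ord mulnA.
Qed.
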